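(* Let $R$ be an associative ring with identity. The following conditions are equivalent for a left $R$-module $M$: (1) Every injective left $R$-module belongs to $\mathfrak{F}^{-1}(M)$. (2) $E(M)\in\mathfrak{F}^{-1}(M)$. (3) For any flat right $R$-module $F$, $F^+\in\mathfrak{F}^{-1}(M)$. (4) $M$ embeds in a flat module. (5) For any injective left $R$-module $E$ and any submodule $N$ of $E$, if $N\in M^{\perp}$ then $E/N\in\mathfrak{F}^{-1}(M)$.
   Context: Modules are unital left $R$-modules unless stated otherwise. $E(M)$ is the injective envelope of $M$; $F^+=\mathrm{Hom}_{\mathbb{Z}}(F,\mathbb{Q}/\mathbb{Z})$ is the character module of $F$; $M^{\perp}=\{N : \mathrm{Ext}^1(M,N)=0\}$. A flat precover of a module $N$ is a morphism $g:F\to N$ with $F$ flat such that $\mathrm{Hom}(F',F)\to\mathrm{Hom}(F',N)$ is surjective for every flat module $F'$. The flat-precover completing domain $\mathfrak{F}^{-1}(M)$ is the class of all modules $N$ such that for every morphism $f:M\to N$ and every flat precover $g:F\to N$ there is a morphism $h:M\to F$ with $gh=f$. *)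

(* Defs.v *)
From HB Require Import structures.
From mathcomp Require Import all_boot all_algebra.
From mathcomp Require Import boolp functions.
From mathcomp Require Import freeg.

Set Implicit Arguments.
Unset Strict Implicit.
Unset Printing Implicit Defensive.

Import GRing.Theory.
Local Open Scope ring_scope.
Local Open Scope quotient_scope.

(* Left R-modules are [lmodType R]; right R-modules are [lmodType R^c], the
   right action x . r being [r *: x]. *)

Section Submodules.
Variables (R : pzRingType) (E : lmodType R) (N : submodClosed E).

(* [submodClosed] carries no [opprClosed] instance, although closure under
   opposites follows from closure under scaling. *)
Definition submod_mem : {pred E} := fun x => x \in N.

Lemma submod_mem_closed : submod_closed submod_mem.
Proof.
split=> [|a x y hx hy]; first exact: (rpred0 N).
have: a *: x + y \in N by apply: rpredD => //; apply: rpredZ.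
by [].
Qed.

HB.instance Definition _ :=
  GRing.isSubmodClosed.Build R E submod_mem submod_mem_closed.
HB.instance Definition _ :=
  GRing.isZmodClosed.Build E submod_mem (GRing.submod_closedB submod_mem_closed).

Definition submod : predArgType := {x : E | x \in submod_mem}.
HB.instance Definition _ := SubChoice.on submod.
HB.instance Definition _ := [SubChoice_isSubZmodule of submod by <:].
HB.instance Definition _ := [SubZmodule_isSubLmodule of submod by <:].

Definition quotmod : Type := @Quotient.quot E submod_mem.
HB.instance Definition _ := GRing.Zmodule.on quotmod.

Definition quotmod_pi (x : E) : quotmod := \pi_(@Quotient.quot E submod_mem) x.

Lemma quotmod_piE x y : (quotmod_pi x == quotmod_pi y) = (x - y \in N).
Proof. by rewrite [RHS](Quotient.idealrBE submod_mem). Qed.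

Lemma quotmod_pi_surj (q : quotmod) : exists x, quotmod_pi x = q.
Proof.
by exists (repr (q : @Quotient.quot E submod_mem)); rewrite /quotmod_pi reprK.
Qed.

Lemma quotmod_piB x y : quotmod_pi (x - y) = quotmod_pi x - quotmod_pi y.
Proof. by rewrite /quotmod_pi [LHS]raddfB. Qed.

Lemma quotmod_piD x y : quotmod_pi (x + y) = quotmod_pi x + quotmod_pi y.
Proof. by rewrite /quotmod_pi [LHS]raddfD. Qed.

Definition quotmod_scale (r : R) (q : quotmod) : quotmod :=
  quotmod_pi (r *: repr (q : @Quotient.quot E submod_mem)).

Lemma quotmod_scale_pi r x :
  quotmod_scale r (quotmod_pi x) = quotmod_pi (r *: x).
Proof.
apply/eqP; rewrite /quotmod_scale quotmod_piE -scalerBr rpredZ //.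
by rewrite -quotmod_piE /quotmod_pi reprK.
Qed.

Lemma quotmod_scaleA a b q :
  quotmod_scale a (quotmod_scale b q) = quotmod_scale (a * b) q.
Proof.
by case: (quotmod_pi_surj q) => x <-; rewrite !quotmod_scale_pi scalerA.
Qed.

Lemma quotmod_scale1 : left_id 1 quotmod_scale.
Proof.
by move=> q; case: (quotmod_pi_surj q) => x <-; rewrite quotmod_scale_pi scale1r.
Qed.

Lemma quotmod_scaleDr : right_distributive quotmod_scale +%R.
Proof.
move=> a p q; case: (quotmod_pi_surj p) => x <-.
case: (quotmod_pi_surj q) => y <-.
by rewrite -quotmod_piD !quotmod_scale_pi scalerDr quotmod_piD.
Qed.

Lemma quotmod_scaleDl q : {morph quotmod_scale^~ q : a b / a + b}.
Proof.
move=> a b; case: (quotmod_pi_surj q) => x <- /=.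
by rewrite !quotmod_scale_pi scalerDl quotmod_piD.
Qed.

HB.instance Definition _ := GRing.Zmodule_isLmodule.Build R quotmod
  quotmod_scaleA quotmod_scale1 quotmod_scaleDr quotmod_scaleDl.

Lemma quotmod_pi_is_linear : linear quotmod_pi.
Proof.
move=> a x y; rewrite quotmod_piD; congr (_ + _).
by rewrite -quotmod_scale_pi.
Qed.

HB.instance Definition _ :=
  GRing.isLinear.Build R E quotmod *:%R quotmod_pi quotmod_pi_is_linear.

End Submodules.

(* The tensor product of a right and a left module: the free abelian group on
   A * B modulo the subgroup generated by the biadditivity and balancing
   relations. *)
Section Tensor.
Variables (R : pzRingType) (A : lmodType R^c) (B : lmodType R).

Notation gen a b := (<< (a, b) >> : {freeg (A * B)%type / int}).

Inductive tensor_rel : {freeg (A * B)%type / int} -> Prop :=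
| TensorRel0 : tensor_rel 0
| TensorRelB x y : tensor_rel x -> tensor_rel y -> tensor_rel (x - y)
| TensorRelDl a1 a2 b : tensor_rel (gen (a1 + a2) b - gen a1 b - gen a2 b)
| TensorRelDr a b1 b2 : tensor_rel (gen a (b1 + b2) - gen a b1 - gen a b2)
| TensorRelM (a : A) (r : R) (b : B) :
    tensor_rel (gen ((r : R^c) *: a) b - gen a (r *: b)).

Definition tensor_relb : {pred {freeg (A * B)%type / int}} :=
  fun x => `[< tensor_rel x >].

Lemma tensor_relb_closed : zmod_closed tensor_relb.
Proof.
split; first by apply/asboolP; apply: TensorRel0.
by move=> x y /asboolP hx /asboolP hy; apply/asboolP; apply: TensorRelB.
Qed.

HB.instance Definition _ := GRing.isZmodClosed.Build
  {freeg (A * B)%type / int} tensor_relb tensor_relb_closed.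

Definition tensor : Type := @Quotient.quot {freeg (A * B)%type / int} tensor_relb.
HB.instance Definition _ := GRing.Zmodule.on tensor.

Definition tensor_pi (x : {freeg (A * B)%type / int}) : tensor :=
  \pi_(@Quotient.quot {freeg (A * B)%type / int} tensor_relb) x.

Definition tens (a : A) (b : B) : tensor := tensor_pi (gen a b).

Lemma tensor_piP x y : tensor_pi x = tensor_pi y <-> tensor_rel (x - y).
Proof.
split=> [e|h].
  by apply/asboolP; rewrite -/(tensor_relb _) -[tensor_relb _]/(_ \in tensor_relb)
    Quotient.idealrBE; apply/eqP.
by apply/eqP; rewrite -[_ == _]Quotient.idealrBE; apply/asboolP.
Qed.

Lemma tensor_pi_is_zmod_morphism : zmod_morphism tensor_pi.
Proof. by move=> x y; rewrite /tensor_pi [LHS]raddfB. Qed.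

HB.instance Definition _ := GRing.isZmodMorphism.Build
  {freeg (A * B)%type / int} tensor tensor_pi tensor_pi_is_zmod_morphism.

Lemma tensDl a1 a2 b : tens (a1 + a2) b = tens a1 b + tens a2 b.
Proof.
rewrite /tens -raddfD; apply/tensor_piP.
by rewrite opprD addrA; apply: TensorRelDl.
Qed.

Lemma tensDr a b1 b2 : tens a (b1 + b2) = tens a b1 + tens a b2.
Proof.
rewrite /tens -raddfD; apply/tensor_piP.
by rewrite opprD addrA; apply: TensorRelDr.
Qed.

Lemma tensM (r : R) a b : tens ((r : R^c) *: a) b = tens a (r *: b).
Proof. by apply/tensor_piP; apply: TensorRelM. Qed.

End Tensor.

Section TensorMap.
Variables (R : pzRingType) (A A' : lmodType R^c) (B B' : lmodType R).
Variables (f : {linear A -> A'}) (g : {linear B -> B'}).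

Definition free_map :
    {freeg (A * B)%type / int} -> {freeg (A' * B')%type / int} :=
  fglift (fun ab : (A * B)%type => << (f ab.1, g ab.2) >>).

Definition tensor_map (x : tensor A B) : tensor A' B' :=
  tensor_pi (free_map (repr (x : @Quotient.quot {freeg (A * B)%type / int} (@tensor_relb R A B)))).

Lemma free_mapB x y : free_map (x - y) = free_map x - free_map y.
Proof. exact: lift_is_additive. Qed.

Lemma free_mapU a b : free_map << (a, b) >> = << (f a, g b) >>.
Proof. by rewrite /free_map liftU scale1r. Qed.

Lemma free_map_rel x : tensor_rel x -> tensor_rel (free_map x).
Proof.
elim=> [|u v _ hu _ hv|a1 a2 b|a b1 b2|a r b].
- by rewrite -[0](subrr 0) free_mapB subrr; apply: TensorRel0.
- by rewrite free_mapB; apply: TensorRelB.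
- by rewrite !free_mapB !free_mapU linearD; apply: TensorRelDl.
- by rewrite !free_mapB !free_mapU linearD; apply: TensorRelDr.
- by rewrite !free_mapB !free_mapU !linearZ; apply: TensorRelM.
Qed.

Lemma tensor_map_pi x : tensor_map (tensor_pi x) = tensor_pi (free_map x).
Proof.
apply/tensor_piP; rewrite -free_mapB; apply: free_map_rel.
by apply/tensor_piP; rewrite /tensor_pi reprK.
Qed.

Lemma tensor_map_is_zmod_morphism : zmod_morphism tensor_map.
Proof.
move=> x y; have pi_surj (z : tensor A B) : exists u, tensor_pi u = z.
  by exists (repr (z : @Quotient.quot {freeg (A * B)%type / int} (@tensor_relb R A B))); rewrite /tensor_pi reprK.
case: (pi_surj x) => u <-; case: (pi_surj y) => v <-.
by rewrite -raddfB !tensor_map_pi free_mapB raddfB.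
Qed.

HB.instance Definition _ := GRing.isZmodMorphism.Build
  (tensor A B) (tensor A' B') tensor_map tensor_map_is_zmod_morphism.

Lemma tensor_map_tens a b : tensor_map (tens a b) = tens (f a) (g b).
Proof. by rewrite /tens tensor_map_pi free_mapU. Qed.

End TensorMap.

Definition rat_intb : {pred rat} := fun q => q \is a Num.int.

Lemma rat_intb_closed : zmod_closed rat_intb.
Proof. by split=> [|x y hx hy]; [exact: rpred0 | exact: rpredB]. Qed.

HB.instance Definition _ := GRing.isZmodClosed.Build rat rat_intb rat_intb_closed.

Definition QmodZ : Type := @Quotient.quot rat rat_intb.
HB.instance Definition _ := GRing.Zmodule.on QmodZ.

(* F^+ = Hom_Z(F, Q/Z) for a right module F, with (r phi)(x) = phi (x . r). *)
Section CharacterModule.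
Variables (R : pzRingType) (F : lmodType R^c).

Definition is_character : {pred F -> QmodZ} :=
  fun phi => `[< zmod_morphism phi >].

Lemma is_character_closed : zmod_closed is_character.
Proof.
split; first by apply/asboolP => x y; rewrite subr0.
move=> p q /asboolP hp /asboolP hq; apply/asboolP => x y.
by rewrite /= !fctE hp hq !opprD !opprK addrACA.
Qed.

HB.instance Definition _ :=
  GRing.isZmodClosed.Build (F -> QmodZ) is_character is_character_closed.

Definition charmod : predArgType := {phi : F -> QmodZ | phi \in is_character}.
HB.instance Definition _ := SubChoice.on charmod.
HB.instance Definition _ := [SubChoice_isSubZmodule of charmod by <:].

Lemma charmodB (phi : charmod) : zmod_morphism (val phi).
Proof. by case: phi => phi /= /asboolP. Qed.

Lemma charmodD (phi : charmod) x y : val phi (x + y) = val phi x + val phi y.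
Proof.
have phi0 : val phi 0 = 0 by rewrite -[0 in LHS](subrr 0) charmodB subrr.
by rewrite -[y in LHS]opprK -[- y]sub0r !charmodB phi0 sub0r opprK.
Qed.

Lemma charmod_scale_subproof (r : R) (phi : charmod) :
  (fun x : F => val phi ((r : R^c) *: x)) \in is_character.
Proof. by apply/asboolP => x y; rewrite scalerBr charmodB. Qed.

Definition charmod_scale (r : R) (phi : charmod) : charmod :=
  Sub (fun x : F => val phi ((r : R^c) *: x)) (charmod_scale_subproof r phi).

Lemma charmod_scaleA a b phi :
  charmod_scale a (charmod_scale b phi) = charmod_scale (a * b) phi.
Proof. by apply/val_inj/funext => x /=; rewrite scalerA. Qed.

Lemma charmod_scale1 : left_id 1 charmod_scale.
Proof. by move=> phi; apply/val_inj/funext => x /=; rewrite scale1r. Qed.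

Lemma charmod_scaleDr : right_distributive charmod_scale +%R.
Proof. by move=> a p q; apply/val_inj/funext. Qed.

Lemma charmod_scaleDl phi : {morph charmod_scale^~ phi : a b / a + b}.
Proof.
move=> a b; apply/val_inj/funext => x /=; rewrite !fctE scalerDl.
by rewrite charmodD.
Qed.

HB.instance Definition _ := GRing.Zmodule_isLmodule.Build R charmod
  charmod_scaleA charmod_scale1 charmod_scaleDr charmod_scaleDl.

End CharacterModule.

Definition flat (R : pzRingType) (F : lmodType R) : Prop :=
  forall (A B : lmodType R^c) (f : {linear A -> B}),
    injective f -> injective (tensor_map f (idfun : {linear F -> F})).

Definition right_flat (R : pzRingType) (F : lmodType R^c) : Prop :=
  forall (A B : lmodType R) (f : {linear A -> B}),
    injective f -> injective (tensor_map (idfun : {linear F -> F}) f).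

Section Homological.
Variable R : pzRingType.

Definition surjective_fun (T U : Type) (f : T -> U) : Prop :=
  forall y, exists x, f x = y.

Definition exact_at (A B C : lmodType R)
    (f : {linear A -> B}) (g : {linear B -> C}) : Prop :=
  forall y, g y = 0 <-> exists x, f x = y.

Definition injective_module (E : lmodType R) : Prop :=
  forall (A B : lmodType R) (i : {linear A -> B}) (f : {linear A -> E}),
    injective i -> exists g : {linear B -> E}, forall x, g (i x) = f x.

Definition projective_module (P : lmodType R) : Prop :=
  forall (A B : lmodType R) (p : {linear A -> B}) (f : {linear P -> B}),
    surjective_fun p -> exists g : {linear P -> A}, forall x, p (g x) = f x.

Definition essential_mono (M E : lmodType R) (i : {linear M -> E}) : Prop :=
  injective i /\
  forall K : submodClosed E, (exists2 y, y \in K & y != 0) ->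
    exists2 x, i x \in K & i x != 0.

Definition injective_envelope (M E : lmodType R) (i : {linear M -> E}) : Prop :=
  injective_module E /\ essential_mono i.

(* The initial segment P2 -> P1 -> P0 -> M -> 0 of a projective resolution;
   Ext^1(M, -) depends on no further term. *)
Definition projective_resolution_upto2 (M P0 P1 P2 : lmodType R)
    (e : {linear P0 -> M}) (d1 : {linear P1 -> P0}) (d2 : {linear P2 -> P1}) :
    Prop :=
  [/\ [/\ projective_module P0, projective_module P1 & projective_module P2],
      surjective_fun e, exact_at d1 e & exact_at d2 d1].

(* Ext^1(M, N) = H^1(Hom(P, N)) = 0: every 1-cocycle is a 1-coboundary. *)
Definition Ext1_zero (M N : lmodType R) : Prop :=
  forall (P0 P1 P2 : lmodType R)
    (e : {linear P0 -> M}) (d1 : {linear P1 -> P0}) (d2 : {linear P2 -> P1}),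
    projective_resolution_upto2 e d1 d2 ->
    forall c : {linear P1 -> N}, (forall x, c (d2 x) = 0) ->
      exists b : {linear P0 -> N}, forall x, c x = b (d1 x).

Definition flat_precover (F N : lmodType R) (g : {linear F -> N}) : Prop :=
  flat F /\
  forall (F' : lmodType R) (f : {linear F' -> N}), flat F' ->
    exists h : {linear F' -> F}, forall x, g (h x) = f x.

(* N belongs to the flat-precover completing domain of M. *)
Definition fpc_domain (M N : lmodType R) : Prop :=
  forall (f : {linear M -> N}) (F : lmodType R) (g : {linear F -> N}),
    flat_precover g -> exists h : {linear M -> F}, forall x, g (h x) = f x.

End Homological.

(* Main.v *)
Require Import Defs.
From HB Require Import structures.
From mathcomp Require Import all_boot all_order all_algebra.
From mathcomp Require Import boolp classical_sets functions fsbigop freeg.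

(* The heart of the matter is that every module [N] has a flat precover; the
   implications are then formal.  If [M] embeds in [E] and [E] lies in the
   domain of [M], lifting the embedding through a flat precover of [E] embeds
   [M] in a flat module; conversely a map from [M] to an injective [E] extends
   along an embedding of [M] in a flat module, and vanishing of Ext^1(M, N)
   lifts maps from [M] to [E / N] to [E].

   Flat precovers are obtained by the argument of Bican and El Bashir: a map
   [F -> N] from a flat module factors through a flat quotient of [F] whose
   cardinality is bounded in terms of [R] and [N], so that the direct sum of
   all small flat modules over [N] is a precover.  Cardinals are replaced by an
   explicit inductive type of names: a subset [S] of [F] closed under
   realization of the types of small submodules over [N] is named by
   well-founded trees, and if [S] is not all of [F] then moving a small
   submodule into [S] and taking differences yields a nonzero pure submodule of
   [F] inside the kernel. *)

Set Implicit Arguments.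
Unset Strict Implicit.
Unset Printing Implicit Defensive.

Import GRing.Theory Num.Theory Order.TTheory.
Local Open Scope ring_scope.

(** * Linear maps, submodules and direct sums *)

Lemma additive_exists (U V : zmodType) (f : U -> V) :
  zmod_morphism f -> exists g : {additive U -> V}, g =1 f.
Proof.
move=> fB; pose g : {additive U -> V} :=
  HB.pack f (GRing.isZmodMorphism.Build U V f fB).
by exists g.
Qed.

Lemma linear_exists (R : pzRingType) (U V : lmodType R) (f : U -> V) :
  linear f -> exists g : {linear U -> V}, g =1 f.
Proof.
move=> lf.
pose g : {linear U -> V} := HB.pack f (GRing.isLinear.Build R U V *:%R f lf).
by exists g.
Qed.

Lemma linear_factor (R : pzRingType) (P M E : lmodType R)
    (e : {linear P -> M}) (h : {linear P -> E}) :
  surjective_fun e -> (forall x, e x = 0 -> h x = 0) ->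
  exists g : {linear M -> E}, forall x, g (e x) = h x.
Proof.
move=> /choice[s es] ker.
have hE x y : e x = e y -> h x = h y.
  move=> exy; apply/eqP; rewrite -subr_eq0 -linearB; apply/eqP/ker.
  by rewrite linearB exy subrr.
have [|g gE] := @linear_exists _ _ _ (h \o s).
  by move=> a x y /=; rewrite -linearP; apply: hE; rewrite linearP !es.
by exists g => x; rewrite gE; apply: hE; rewrite es.
Qed.

Section SubmoduleSets.
Variables (R : pzRingType) (E : lmodType R).

Definition is_submodule (K : set E) : Prop :=
  K 0 /\ forall a x y, K x -> K y -> K (a *: x + y).

Lemma is_submoduleD K x y : is_submodule K -> K x -> K y -> K (x + y).
Proof. by move=> [_ KP] Kx Ky; rewrite -[x]scale1r; apply: KP. Qed.

Lemma is_submoduleZ K a x : is_submodule K -> K x -> K (a *: x).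
Proof. by move=> [K0 KP] Kx; rewrite -[_ *: _]addr0; apply: KP. Qed.

Lemma bigcup_chain_is_submodule (C : set (set E)) :
  (forall X, C X -> is_submodule X) -> total_on C subset -> (exists X, C X) ->
  is_submodule (\bigcup_(X in C) X)%classic.
Proof.
move=> Cs Ctot [X0 CX0]; split; first by exists X0 => //; case: (Cs _ CX0).
move=> a x y [X CX Xx] [Y CY Yy].
have [XY|YX] := Ctot _ _ CX CY.
  by exists Y => //; case: (Cs _ CY) => _; apply=> //; apply: XY.
by exists X => //; case: (Cs _ CX) => _; apply=> //; apply: YX.
Qed.

Section Pack.
Variables (K : set E) (Ks : is_submodule K).

Definition set_pred : {pred E} := fun x => `[< K x >].

Lemma set_pred_closed : submod_closed set_pred.
Proof.
case: Ks => K0 KP; split=> [|a x y /asboolP Kx /asboolP Ky]; apply/asboolP => //.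
exact: KP.
Qed.

(** Zorn's lemma works with [set E], quotients with a bundled boolean predicate; this passes from
    the first to the second. *)
Definition submodClosed_of_set : submodClosed E :=
  HB.pack set_pred (GRing.isSubmodClosed.Build R E set_pred set_pred_closed).

Lemma submodClosed_of_setP x : x \in submodClosed_of_set <-> K x.
Proof. by split=> /asboolP. Qed.

Definition quotient_of_set : lmodType R := quotmod submodClosed_of_set.

Definition quotient_pi : {linear E -> quotient_of_set} :=
  @quotmod_pi R E submodClosed_of_set.

Lemma quotient_pi_surj : surjective_fun quotient_pi.
Proof. exact: quotmod_pi_surj. Qed.

Lemma quotient_pi_eq0 x : quotient_pi x = 0 <-> K x.
Proof.
rewrite -submodClosed_of_setP -[x in x \in _]subr0 -quotmod_piE.
have -> : quotmod_pi submodClosed_of_set 0 = 0 by apply: (raddf0 quotient_pi).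
by split=> [->|/eqP].
Qed.

End Pack.

End SubmoduleSets.

Section DirectSum.
Variables (R : pzRingType) (I : choiceType) (M : I -> lmodType R).

Definition finsupp (f : forall i, M i) : Prop :=
  exists s : seq I, forall i, i \notin s -> f i = 0.

Record dsum : Type :=
  DSum { dsum_val :> forall i, M i; dsum_finsupp : finsupp dsum_val }.

Lemma dsumP (f g : dsum) : (forall i, f i = g i) -> f = g.
Proof.
case: f g => [f pf] [g pg] /= fg.
have E : f = g by apply: functional_extensionality_dep.
by case: _ / E pg => pg; congr DSum; apply: Prop_irrelevance.
Qed.

HB.instance Definition _ := gen_eqMixin dsum.
HB.instance Definition _ := gen_choiceMixin dsum.

Lemma finsupp0 : finsupp (fun i => 0). Proof. by exists [::]. Qed.
Lemma finsuppD (f g : dsum) : finsupp (fun i => f i + g i).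
Proof.
case: (dsum_finsupp f) (dsum_finsupp g) => [s sf] [t tg].
exists (s ++ t) => i; rewrite mem_cat negb_or => /andP[/sf -> /tg ->].
by rewrite addr0.
Qed.
Lemma finsuppN (f : dsum) : finsupp (fun i => - f i).
Proof. by case: (dsum_finsupp f) => s sf; exists s => i /sf ->; rewrite oppr0. Qed.
Lemma finsuppZ a (f : dsum) : finsupp (fun i => a *: f i).
Proof. by case: (dsum_finsupp f) => s sf; exists s => i /sf ->; rewrite scaler0. Qed.

Let dadd f g := DSum (finsuppD f g).
Let dopp f := DSum (finsuppN f).
Let dscale a f := DSum (finsuppZ a f).
Let daddA : associative dadd.
Proof. by move=> f g h; apply: dsumP => i /=; rewrite addrA. Qed.
Let daddC : commutative dadd.
Proof. by move=> f g; apply: dsumP => i /=; rewrite addrC. Qed.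
Let dadd0 : left_id (DSum finsupp0) dadd.
Proof. by move=> f; apply: dsumP => i /=; rewrite add0r. Qed.
Let daddN : left_inverse (DSum finsupp0) dopp dadd.
Proof. by move=> f; apply: dsumP => i /=; rewrite addNr. Qed.
HB.instance Definition _ := GRing.isZmodule.Build dsum daddA daddC dadd0 daddN.
Let dscaleA a b f : dscale a (dscale b f) = dscale (a * b) f.
Proof. by apply: dsumP => i /=; rewrite scalerA. Qed.
Let dscale1 : left_id 1 dscale.
Proof. by move=> f; apply: dsumP => i /=; rewrite scale1r. Qed.
Let dscaleDr : right_distributive dscale +%R.
Proof. by move=> a f g; apply: dsumP => i /=; rewrite scalerDr. Qed.
Let dscaleDl f : {morph dscale^~ f : a b / a + b}.
Proof. by move=> a b; apply: dsumP => i /=; rewrite scalerDl. Qed.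
HB.instance Definition _ := GRing.Zmodule_isLmodule.Build R dsum
  dscaleA dscale1 dscaleDr dscaleDl.

Lemma dsumDE (f g : dsum) i : (f + g) i = f i + g i. Proof. by []. Qed.
Lemma dsumZE a (f : dsum) i : (a *: f) i = a *: f i. Proof. by []. Qed.
Lemma dsum_sumE (J : Type) (s : seq J) (F : J -> dsum) i :
  (\sum_(j <- s) F j) i = \sum_(j <- s) F j i.
Proof. by elim: s => [|j s IH]; rewrite ?big_nil ?big_cons // dsumDE IH. Qed.

Lemma dsum_in_finsupp i (x : M i) : finsupp (dfwith (fun j => 0 : M j) x).
Proof.
exists [:: i] => j; rewrite inE => ji.
by rewrite dfwith_out // eq_sym.
Qed.
Definition dsum_in i (x : M i) : dsum := DSum (dsum_in_finsupp x).

Lemma dsum_inE i (x : M i) : dsum_in x i = x.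
Proof. exact: dfwith_in. Qed.
Lemma dsum_inN i (x : M i) j : i != j -> dsum_in x j = 0.
Proof. exact: dfwith_out. Qed.

Lemma dsum_in_linear i : linear (@dsum_in i).
Proof.
move=> a x y; apply: dsumP => j; rewrite dsumDE dsumZE.
have [e|ij] := eqVneq i j; first by case: _ / e; rewrite !dsum_inE.
by rewrite !dsum_inN // scaler0 addr0.
Qed.
HB.instance Definition _ i :=
  GRing.isLinear.Build R (M i) dsum *:%R (@dsum_in i) (@dsum_in_linear i).

Lemma dsum_decomp (f : dsum) s : uniq s -> (forall i, i \notin s -> f i = 0) ->
  f = \sum_(i <- s) dsum_in (f i).
Proof.
move=> us sf; apply: dsumP => j; rewrite dsum_sumE.
have [js|js] := boolP (j \in s).
  rewrite (bigD1_seq j) // dsum_inE big1 => [|i ij]; last by rewrite dsum_inN.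
  by rewrite [RHS]addr0.
rewrite sf // big_seq big1 // => i si; rewrite dsum_inN //.
by apply: contraNneq js => <-.
Qed.

Lemma dsum_ind (P : dsum -> Prop) : P 0 -> (forall f g, P f -> P g -> P (f + g)) ->
  (forall i (x : M i), P (dsum_in x)) -> forall f, P f.
Proof.
move=> P0 PD Pin f; have [s sf] := dsum_finsupp f.
rewrite (@dsum_decomp f (undup s)) ?undup_uniq //; last first.
  by move=> i; rewrite mem_undup; apply: sf.
by elim/big_ind: _.
Qed.

Section Lift.
Variables (N : zmodType) (h : forall i, {additive M i -> N}).

(** The sum over the full index set has finite support, so no list of indices is chosen;
    [dsum_liftE] computes it on any list covering the support. *)
Definition dsum_lift (f : dsum) : N := \sum_(i \in [set: I]) h i (f i).

Lemma dsum_liftE (f : dsum) s : uniq s -> (forall i, i \notin s -> f i = 0) ->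
  dsum_lift f = \sum_(i <- s) h i (f i).
Proof.
move=> us sf; rewrite /dsum_lift (@fsbigE _ _ _ _ _ s) //.
  by apply: eq_bigl => i; rewrite in_setT.
by move=> i _ /sf ->; rewrite raddf0.
Qed.

Lemma dsum_liftD : {morph dsum_lift : f g / f + g}.
Proof.
move=> f g; have [s sf] := dsum_finsupp f; have [t tg] := dsum_finsupp g.
pose u := undup (s ++ t).
have fu i : i \notin u -> f i = 0.
  by rewrite mem_undup mem_cat negb_or => /andP[/sf].
have gu i : i \notin u -> g i = 0.
  by rewrite mem_undup mem_cat negb_or => /andP[_ /tg].
rewrite !(@dsum_liftE _ u) ?undup_uniq // -?big_split.
  by apply: eq_bigr => i _; rewrite dsumDE raddfD.
by move=> i iu; rewrite dsumDE fu ?gu ?addr0.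
Qed.

Lemma dsum_lift_in i (x : M i) : dsum_lift (dsum_in x) = h i x.
Proof.
rewrite (@dsum_liftE _ [:: i]) ?big_seq1 ?dsum_inE // => j.
by rewrite inE => ji; rewrite dsum_inN // eq_sym.
Qed.

Lemma dsum_lift_is_zmod_morphism : zmod_morphism dsum_lift.
Proof.
by move=> f g; have := dsum_liftD (f - g) g; rewrite subrK => ->; rewrite addrK.
Qed.

End Lift.

Lemma dsum_lift_linear (N : lmodType R) (h : forall i, {linear M i -> N}) :
  exists g : {linear dsum -> N}, forall i x, g (dsum_in x) = h i x.
Proof.
have [|g gE] := @linear_exists _ _ _ (dsum_lift h).
  move=> a f g; rewrite dsum_liftD; congr (_ + _).
  have [s sf] := dsum_finsupp f.
  rewrite !(@dsum_liftE _ _ _ (undup s)) ?undup_uniq ?scaler_sumr //.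
  - by apply: eq_bigr => i _; apply: (linearZ_LR (h i)).
  - by move=> i; rewrite mem_undup => /sf.
  - by move=> i; rewrite mem_undup dsumZE => /sf ->; rewrite scaler0.
by exists g => i x; rewrite gE dsum_lift_in.
Qed.

End DirectSum.

Section FreeModule.
Variables (R : pzRingType) (T : choiceType).

Definition free_module : lmodType R := @dsum R T (fun=> R^o).
Definition free_gen (t : T) : free_module := @dsum_in R T (fun=> R^o) t 1.

Lemma free_lift (N : lmodType R) (f : T -> N) :
  exists g : {linear free_module -> N}, forall t, g (free_gen t) = f t.
Proof.
have lin t : linear ((fun r : R => r *: f t) : R^o -> N).
  by move=> a x y; rewrite scalerDl scalerA.
have /choice[h hE] t := linear_exists (lin t).
have [g gE] := dsum_lift_linear h; exists g => t.
by rewrite gE hE scale1r.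
Qed.

Lemma free_ind (P : free_module -> Prop) : P 0 ->
  (forall f g, P f -> P g -> P (f + g)) -> (forall a t, P (a *: free_gen t)) ->
  forall f, P f.
Proof.
move=> P0 PD Pg; apply: dsum_ind => // t a.
by rewrite -[a]mulr1 -[a * 1]/(a *: (1 : R^o)) linearZ; apply: Pg.
Qed.

Lemma free_ext (N : lmodType R) (f g : {linear free_module -> N}) :
  (forall t, f (free_gen t) = g (free_gen t)) -> f =1 g.
Proof.
move=> fg; apply: free_ind => [|u v fu fv|a t]; first by rewrite !linear0.
  by rewrite !linearD fu fv.
by rewrite !linearZ fg.
Qed.

Lemma free_projective : projective_module free_module.
Proof.
move=> A B p f /choice[s ps]; have [g gE] := free_lift (fun t => s (f (free_gen t))).
exists g => x; have: p \o g =1 f by apply: free_ext => t /=; rewrite gE ps.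
exact.
Qed.

End FreeModule.

(** * Tensor products and the equational criterion for flatness *)

Section FreeGroupLift.
Variables (K : choiceType) (N : zmodType) (f : K -> N).

(** [fglift] expects a module over the integers as target; [zmodule N] is the abelian group [N] seen
    as one. *)
Definition fglift_zmod (u : {freeg K / int}) : N :=
  fglift (f : K -> zmodule N) u.

Lemma fglift_zmod_is_zmod_morphism : zmod_morphism fglift_zmod.
Proof. exact: (@lift_is_additive _ _ (zmodule N) f). Qed.

HB.instance Definition _ := GRing.isZmodMorphism.Build
  {freeg K / int} N fglift_zmod fglift_zmod_is_zmod_morphism.

Lemma fglift_zmodU k : fglift_zmod << k >> = f k.
Proof. by rewrite /fglift_zmod liftU scale1r. Qed.

End FreeGroupLift.

Lemma freeg_int_ind (K : choiceType) (P : {freeg K / int} -> Prop) :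
  P 0 -> (forall u v, P u -> P v -> P (u - v)) -> (forall k, P << k >>) ->
  forall u, P u.
Proof.
move=> P0 PB PU u; rewrite -[u]freeg_sumE.
have PN v : P v -> P (- v) by move=> Pv; rewrite -sub0r; apply: PB.
have PD v w : P v -> P w -> P (v + w).
  by move=> Pv Pw; rewrite -[w]opprK; apply: PB => //; apply: PN.
apply: (big_ind P) => // k _; rewrite -[coeff k u]intz -freegU_mulz.
case: (coeff k u) => n.
  by elim: n => [|n IH] //; rewrite -pmulrn mulrS; apply: PD; rewrite ?pmulrn.
by apply: PN; elim: n => [|n IH] //; rewrite mulrS; apply: PD.
Qed.

Section TensorUniversal.
Variables (R : pzRingType) (A : lmodType R^c) (B : lmodType R).

Lemma tensor_pi_surj (z : tensor A B) : exists u, tensor_pi u = z.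
Proof.
exists (repr (z : @Quotient.quot {freeg (A * B)%type / int} (@tensor_relb R A B))).
by rewrite /tensor_pi reprK.
Qed.

Lemma tensor_ind (P : tensor A B -> Prop) : P 0 ->
  (forall u v, P u -> P v -> P (u - v)) -> (forall a b, P (tens a b)) ->
  forall z, P z.
Proof.
move=> P0 PB Pt z; have [u <-] := tensor_pi_surj z; elim/freeg_int_ind: u.
- by rewrite raddf0.
- by move=> u v Pu Pv; rewrite raddfB; apply: PB.
- by move=> [a b]; apply: Pt.
Qed.

Lemma tensor_lift (N : zmodType) (f : A -> B -> N) :
  (forall a1 a2 b, f (a1 + a2) b = f a1 b + f a2 b) ->
  (forall a b1 b2, f a (b1 + b2) = f a b1 + f a b2) ->
  (forall (r : R) a b, f ((r : R^c) *: a) b = f a (r *: b)) ->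
  exists g : tensor A B -> N, zmod_morphism g /\ forall a b, g (tens a b) = f a b.
Proof.
move=> fDl fDr fM.
pose g : {additive {freeg (A * B)%type / int} -> N} :=
  fglift_zmod (fun p : A * B => f p.1 p.2).
have gU a b : g << (a, b) >> = f a b by apply: fglift_zmodU.
have g0 u : tensor_rel u -> g u = 0.
  elim=> [|v w _ gv _ gw|a1 a2 b|a b1 b2|a r b]; rewrite ?raddf0 // !raddfB.
  - by rewrite gv gw subr0.
  - by rewrite !gU fDl addrAC addrK subrr.
  - by rewrite !gU fDr addrAC addrK subrr.
  - by rewrite !gU fM subrr.
have [s sP] := choice tensor_pi_surj.
have gs u : g (s (tensor_pi u)) = g u.
  apply/eqP; rewrite -subr_eq0 -raddfB; apply/eqP/g0.
  by apply/tensor_piP; rewrite sP.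
exists (g \o s); split=> [x y|a b] /=; last first.
  by rewrite /tens gs gU.
by rewrite -[x in LHS]sP -[y in LHS]sP -raddfB gs raddfB.
Qed.

Lemma tens0l (b : B) : tens (0 : A) b = 0.
Proof. by apply: (addrI (tens 0 b)); rewrite -tensDl !addr0. Qed.

Lemma tens0r (a : A) : tens a (0 : B) = 0.
Proof. by apply: (addrI (tens a 0)); rewrite -tensDr !addr0. Qed.

Lemma tensBl a1 a2 (b : B) : tens (a1 - a2 : A) b = tens a1 b - tens a2 b.
Proof. by apply: (addIr (tens a2 b)); rewrite -tensDl !subrK. Qed.

Lemma tens_suml (J : Type) (s : seq J) (f : J -> A) (b : B) :
  tens (\sum_(j <- s) f j) b = \sum_(j <- s) tens (f j) b.
Proof. by elim: s => [|j s IH]; rewrite ?big_nil ?tens0l // !big_cons tensDl IH. Qed.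

Lemma tens_sumr (J : Type) (s : seq J) (a : A) (f : J -> B) :
  tens a (\sum_(j <- s) f j) = \sum_(j <- s) tens a (f j).
Proof. by elim: s => [|j s IH]; rewrite ?big_nil ?tens0r // !big_cons tensDr IH. Qed.

End TensorUniversal.

Section EquationalCriterion.
Variable R : pzRingType.

(* A relation [sum_i r_i x_i = 0] is trivial when it already holds formally:
   [x = c y] for a matrix [c] over [R] with [r c = 0]. *)
Definition trivial_relation (F : lmodType R) (I : finType) (r : I -> R)
    (x : I -> F) : Prop :=
  exists (J : finType) (c : I -> J -> R) (y : J -> F),
    (forall i, x i = \sum_j c i j *: y j) /\ (forall j, \sum_i r i * c i j = 0).

Definition equationally_flat (F : lmodType R) : Prop :=
  forall (I : finType) (r : I -> R) (x : I -> F),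
    \sum_i r i *: x i = 0 -> trivial_relation r x.

Section TrivialRelation.
Variables (F : lmodType R) (I : finType) (r : I -> R).

Lemma trivial_relation0 : trivial_relation r (fun=> 0 : F).
Proof.
exists void, (fun _ => of_void R), (of_void F).
by split=> [i|[]]; rewrite big1 // => -[].
Qed.

Lemma trivial_relation1 (c : I -> R) (y : F) :
  \sum_i r i * c i = 0 -> trivial_relation r (fun i => c i *: y).
Proof.
move=> rc; exists unit, (fun i _ => c i), (fun=> y).
by split=> // i; rewrite (bigD1 tt) //= big1 ?addr0 // => -[].
Qed.

Lemma trivial_relationB (x1 x2 : I -> F) : trivial_relation r x1 ->
  trivial_relation r x2 -> trivial_relation r (fun i => x1 i - x2 i).
Proof.
move=> [J1 [c1 [y1 [x1E r1]]]] [J2 [c2 [y2 [x2E r2]]]].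
exists (J1 + J2)%type,
  (fun i j => match j with inl j => c1 i j | inr j => c2 i j end),
  (fun j => match j with inl j => y1 j | inr j => - y2 j end).
split=> [i|[j|j] //]; rewrite big_sumType /= x1E x2E -sumrN; congr (_ + _).
by apply: eq_bigr => j _; rewrite scalerN.
Qed.

Lemma trivial_relationD (x1 x2 : I -> F) : trivial_relation r x1 ->
  trivial_relation r x2 -> trivial_relation r (fun i => x1 i + x2 i).
Proof.
move=> t1 t2; have := trivial_relationB t1 (trivial_relationB trivial_relation0 t2).
by under [X in trivial_relation r X]eq_fun do rewrite sub0r opprK.
Qed.

Lemma trivial_relation_sum (J : Type) (s : seq J) (x : J -> I -> F) :
  (forall j, trivial_relation r (x j)) ->
  trivial_relation r (fun i => \sum_(j <- s) x j i).
Proof.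
move=> tx; elim: s => [|j s IH].
  by under eq_fun do rewrite big_nil; apply: trivial_relation0.
by under eq_fun do rewrite big_cons; apply: trivial_relationD.
Qed.

Lemma trivial_relation_map (F' : lmodType R) (f : {linear F -> F'}) (x : I -> F) :
  trivial_relation r x -> trivial_relation r (fun i => f (x i)).
Proof.
move=> [J [c [y [xE rc]]]]; exists J, c, (fun j => f (y j)); split=> // i.
by rewrite xE linear_sum; apply: eq_bigr => j _; rewrite linearZ.
Qed.

End TrivialRelation.

(** Induction on the list: once the earlier relations are solved by [x = c y], the next becomes a
    single relation on [y]. Solving it multiplies [c] by a further matrix, which keeps the earlier
    products zero. *)
Lemma equationally_flat_system (F : lmodType R) (I : finType)
    (T : eqType) (a : T -> I -> R) (L : seq T) (x : I -> F) : equationally_flat F ->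
  {in L, forall t, \sum_i a t i *: x i = 0} ->
  exists (J : finType) (c : I -> J -> R) (y : J -> F),
    (forall i, x i = \sum_j c i j *: y j) /\
    {in L, forall t j, \sum_i a t i * c i j = 0}.
Proof.
move=> flF; elim: L => [|t L IH] Lx.
  exists I, (fun i j => (i == j)%:R), x; split=> // i.
  rewrite (bigD1 i) //= eqxx scale1r big1 ?addr0 // => j ji.
  by rewrite eq_sym (negPf ji) scale0r.
have [u Lu|J [c [y [xE Lc]]]] := IH; first by apply: Lx; rewrite inE Lu orbT.
have ax : \sum_j (\sum_i a t i * c i j) *: y j = 0.
  rewrite -[RHS](Lx t) ?mem_head //.
  under eq_bigr do rewrite scaler_suml.
  rewrite exchange_big; apply: eq_bigr => i _; rewrite xE scaler_sumr.
  by apply: eq_bigr => j _; rewrite scalerA.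
have [J' [c' [y' [yE ac']]]] := flF _ _ _ ax.
exists J', (fun i k => \sum_j c i j * c' j k), y'; split=> [i|u Lu k].
  rewrite xE; under [RHS]eq_bigr do rewrite scaler_suml.
  rewrite exchange_big; apply: eq_bigr => j _; rewrite yE scaler_sumr.
  by apply: eq_bigr => k _; rewrite scalerA.
transitivity (\sum_j (\sum_i a u i * c i j) * c' j k).
  under eq_bigr do rewrite mulr_sumr.
  rewrite exchange_big; apply: eq_bigr => j _; rewrite mulr_suml.
  by apply: eq_bigr => i _; rewrite mulrA.
move: Lu; rewrite inE => /orP[/eqP -> //|Lu]; apply: big1 => j _.
by rewrite Lc // mul0r.
Qed.

(** Let [K] be the right ideal generated by the [r i]. The element [\sum_i tens (r i) (x i)]
    vanishes over the whole ring, hence over [K] by flatness. The map [psi], which replaces an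
    element of [K] by coefficients on the [r i], turns a derivation of this vanishing into a trivial
    relation. *)
Lemma flat_equationally_flat (F : lmodType R) : flat F -> equationally_flat F.
Proof.
move=> flF I r x rx.
pose B : lmodType R^c := (R^c)^o.
pose K : set B := fun b => exists c : I -> R, b = \sum_i r i * c i.
have Ks : is_submodule K.
  split; first by exists (fun=> 0); rewrite big1 // => i _; rewrite mulr0.
  move=> a _ _ [c ->] [d ->]; exists (fun i => c i * a + d i).
  rewrite -[_ *: _]/((\sum_i r i * c i) * a) mulr_suml -big_split.
  by apply: eq_bigr => i _; rewrite mulrDr mulrA.
pose S := submodClosed_of_set Ks; have SE := submodClosed_of_setP Ks.
pose f : {linear submod S -> B} := val.
have fx : \sum_i tens (r i : B) (x i) = 0.
  transitivity (tens ((1 : R) : B) (\sum_i r i *: x i)); last by rewrite rx tens0r.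
  rewrite tens_sumr; apply: eq_bigr => i _; rewrite -tensM; congr tens.
  by rewrite -[RHS]/(1 * r i) mul1r.
have rS i : (r i : B) \in submod_mem S.
  apply/SE; exists (fun j => (j == i)%:R); rewrite (bigD1 i) //= eqxx mulr1.
  by rewrite big1 ?addr0 // => j /negPf ->; rewrite mulr0.
pose a i : submod S := Sub (r i : B) (rS i).
have ax : \sum_i tens (a i) (x i) = 0.
  apply: (flF _ _ f val_inj); rewrite raddf_sum raddf0 -[RHS]fx.
  by apply: eq_bigr => i _; apply: tensor_map_tens.
have sP (b : submod S) : exists c : I -> R, (val b : R) = \sum_i r i * c i.
  by apply/SE; apply: (valP b).
(* The chosen coefficients need not depend additively on the element; the defects are syzygies of
   [r], and these give trivial relations. *)
have {sP}[s sP] := choice sP.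
pose psi : {additive {freeg (submod S * F)%type / int} -> (I -> F)} :=
  fglift_zmod (fun p : submod S * F => (fun i => s p.1 i *: p.2) : I -> F).
have psiU b y : psi << (b, y) >> = fun i => s b i *: y by apply: fglift_zmodU.
have psiP u : tensor_rel u -> trivial_relation r (psi u).
  elim=> [|v w _ IHv _ IHw|a1 a2 b|b y1 y2|b q y]; rewrite ?raddf0 ?raddfB.
  - exact: trivial_relation0.
  - exact: trivial_relationB.
  - rewrite !psiU.
    rewrite [X in trivial_relation _ X](_ : _ =
      fun i => (s (a1 + a2) i - s a1 i - s a2 i) *: b).
      apply: trivial_relation1; under eq_bigr do rewrite !mulrBr.
      by rewrite !sumrB -!sP raddfD addrAC addrK subrr.
    by apply/funext => i; rewrite !scalerBl.
  - rewrite !psiU.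
    rewrite [X in trivial_relation _ X](_ : _ = fun=> 0).
      exact: trivial_relation0.
    by apply/funext => i; rewrite !fctE scalerDr addrAC addrK subrr.
  - rewrite !psiU.
    rewrite [X in trivial_relation _ X](_ : _ =
      fun i => (s ((q : R^c) *: b) i - s b i * q) *: y).
      apply: trivial_relation1; under eq_bigr do rewrite mulrBr mulrA.
      by rewrite sumrB -mulr_suml -!sP linearZ subrr.
    by apply/funext => i; rewrite !fctE scalerBl scalerA.
have : tensor_rel (\sum_i (<< (a i, x i) >> : {freeg _ / int})).
  rewrite -[X in tensor_rel X]subr0; apply/tensor_piP.
  by rewrite raddf0 raddf_sum.
move=> /psiP; rewrite raddf_sum => tx.
(* Both [s (a i)] and the [i]-th unit vector express [r i], so their difference is a syzygy; adding
   these corrections for all [i] gives [x]. *)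
have ty i : trivial_relation r (fun k => ((k == i)%:R - s (a i) k) *: x i).
  apply: trivial_relation1; under eq_bigr do rewrite mulrBr.
  rewrite sumrB -sP (bigD1 i) //= eqxx mulr1 big1 ?addr0 ?subrr // => j /negPf ->.
  by rewrite mulr0.
have := trivial_relationD tx (trivial_relation_sum (index_enum I) ty).
rewrite [X in trivial_relation _ X](_ : _ = x) //; apply/funext => k.
rewrite fct_sumE -big_split (bigD1 k) //= psiU eqxx scalerBl scale1r.
rewrite [X in X + _]addrC subrK big1 ?addr0 // => i ik.
by rewrite psiU eq_sym (negPf ik) scalerBl scale0r sub0r subrr.
Qed.

End EquationalCriterion.

Lemma tensor_sum_tens (R : pzRingType) (A : lmodType R^c) (B : lmodType R)
    (z : tensor A B) :
  exists s : seq (A * B), z = \sum_(p <- s) tens p.1 p.2.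
Proof.
elim/tensor_ind: z => [|_ _ [s ->] [t ->]|a b].
- by exists [::]; rewrite big_nil.
- exists (s ++ [seq (- p.1, p.2) | p <- t]); rewrite big_cat big_map; congr (_ + _).
  rewrite -sumrN; apply: eq_bigr => p _ /=.
  by rewrite -[- p.1]sub0r tensBl tens0l sub0r.
- by exists [:: (a, b)]; rewrite big_seq1.
Qed.

Section EquationallyFlatFlat.
Variables (R : pzRingType) (F : lmodType R).

Definition linearity_at (c : F -> R) (k : (F * F) + (R * F)) : Prop :=
  match k with
  | inl p => c (p.1 + p.2) = c p.1 + c p.2
  | inr p => c (p.1 *: p.2) = p.1 * c p.2
  end.

(* An element of the relation subgroup is killed by every [c : F -> R] which is
   linear at the finitely many places used to derive it. *)
Lemma tensor_rel_linearity (B : lmodType R^c) (u : {freeg (B * F)%type / int}) :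
  tensor_rel u -> exists L : seq ((F * F) + (R * F)),
    forall c : F -> R, {in L, forall k, linearity_at c k} ->
      fglift_zmod (fun p : B * F => (c p.2 : R^c) *: p.1) u = 0.
Proof.
elim=> [|v w _ [L1 h1] _ [L2 h2]|a1 a2 b|a b1 b2|a r b].
- by exists [::] => c _; rewrite raddf0.
- exists (L1 ++ L2) => c hc; rewrite raddfB /= h1 ?h2 ?subr0 // => k kL; apply: hc;
    by rewrite mem_cat kL ?orbT.
- exists [::] => c _; rewrite !raddfB /= !fglift_zmodU /=.
  by rewrite scalerDr addrAC addrK subrr.
- exists [:: inl (b1, b2)] => c /(_ _ (mem_head _ _)) /= hc.
  by rewrite !raddfB /= !fglift_zmodU /= hc scalerDl addrAC addrK subrr.
- exists [:: inr (r, b)] => c /(_ _ (mem_head _ _)) /= hc.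
  by rewrite !raddfB /= !fglift_zmodU /= hc scalerA subrr.
Qed.

(** A derivation of [\sum_p tens (f p.1) p.2 = 0] uses the linear structure of [F] at finitely many
    places. These form a linear system among the elements of a finite list [X]. Solving it gives
    coordinates [d j] that are linear at those places; applying them to the derivation yields
    equations in [B], which come back to [A] along the injective [f]. *)
Lemma equationally_flat_flat : equationally_flat F -> flat F.
Proof.
move=> flF A B f fI; apply: raddf_inj => z; have [s ->] := tensor_sum_tens z.
rewrite raddf_sum => fz.
have : tensor_rel (\sum_(p <- s) << (f p.1, p.2) >> : {freeg (B * F)%type / int}).
  rewrite -[X in tensor_rel X]subr0; apply/tensor_piP.
  rewrite raddf0 raddf_sum -[RHS]fz; apply: eq_bigr => p _ /=.
  by rewrite [RHS]tensor_map_tens.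
move=> /tensor_rel_linearity[L hL].
pose dl (k : (F * F) + (R * F)) : seq F := match k with
  | inl p => [:: p.1 + p.2; p.1; p.2] | inr p => [:: p.1 *: p.2; p.2] end.
pose X := [seq p.2 | p <- s] ++ flatten [seq dl k | k <- L].
(* Indicators are added up, so that coincidences such as [p.1 = p.2] are accounted for. *)
pose row (k : (F * F) + (R * F)) (i : seq_sub X) : R := match k with
  | inl p => (val i == p.1 + p.2)%:R - (val i == p.1)%:R - (val i == p.2)%:R
  | inr p => (val i == p.1 *: p.2)%:R - p.1 * (val i == p.2)%:R end.
have pickX x : x \in X -> \sum_(i : seq_sub X) (val i == x)%:R *: val i = x.
  move=> Xx; rewrite (bigD1 (SeqSub Xx)) //= eqxx scale1r big1 ?addr0 // => i ix.
  rewrite [_ == x](_ : _ = false) ?scale0r //; apply: contraNF ix => /eqP ix.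
  by apply/eqP/val_inj.
have LX k x : k \in L -> x \in dl k -> x \in X.
  move=> kL kx; rewrite mem_cat; apply/orP; right; apply/flattenP.
  by exists (dl k) => //; apply: map_f.
have [|J [c [y [xE Lc]]]] := equationally_flat_system (a := row) (L := L)
    (x := fun i : seq_sub X => val i) flF.
  move=> [[x1 x2]|[q x]] /LX kX /=.
    under eq_bigr do rewrite !scalerBl.
    rewrite !sumrB !pickX ?kX ?inE ?eqxx ?orbT //.
    by rewrite addrAC addrK subrr.
  under eq_bigr do rewrite scalerBl -scalerA.
  by rewrite sumrB -scaler_sumr !pickX ?kX ?inE ?eqxx ?orbT // subrr.
(* This is the entry of [c] in the row of [x] and column [j], and 0 outside [X]; it is a mere
   function on [F]. *)
pose d j x := \sum_(i : seq_sub X) (val i == x)%:R * c i j.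
have dL j : {in L, forall k, linearity_at (d j) k}.
  move=> [[x1 x2]|[q x]] /Lc /(_ j) /=.
    under eq_bigr do rewrite !mulrBl.
    by rewrite !sumrB -addrA -opprD => /eqP; rewrite subr_eq0 => /eqP.
  under eq_bigr do rewrite mulrBl -mulrA.
  by rewrite sumrB -mulr_sumr => /eqP; rewrite subr_eq0 => /eqP.
have dX x : x \in X -> x = \sum_j d j x *: y j.
  move=> /pickX {1}<-; under [RHS]eq_bigr do rewrite scaler_suml.
  rewrite exchange_big; apply: eq_bigr => i _; rewrite {2}xE scaler_sumr.
  by apply: eq_bigr => j _; rewrite scalerA.
have d0 j : \sum_(p <- s) (d j p.2 : R^c) *: p.1 = 0.
  apply: fI; rewrite raddf0 -[RHS](hL _ (dL j)) !raddf_sum.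
  by apply: eq_bigr => p _; rewrite /= [RHS]fglift_zmodU; apply: linearZ_LR.
transitivity (\sum_j tens (\sum_(p <- s) (d j p.2 : R^c) *: p.1) (y j)); last first.
  by apply: big1 => j _; rewrite d0 tens0l.
under [RHS]eq_bigr do rewrite tens_suml.
rewrite exchange_big; apply: eq_big_seq => p ps /=.
rewrite {1}[p.2]dX; last by rewrite mem_cat map_f.
by rewrite tens_sumr; apply: eq_bigr => j _; rewrite tensM.
Qed.

End EquationallyFlatFlat.

(** * Flat quotients and pure submodules *)

Section EquationallyFlatClosure.
Variable R : pzRingType.

Lemma dsum_equationally_flat (I : choiceType) (M : I -> lmodType R) :
  (forall i, equationally_flat (M i)) -> equationally_flat (dsum M).
Proof.
move=> flM K r x rx.
have rxi i : \sum_k r k *: x k i = 0.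
  have : (\sum_k r k *: x k) i = (0 : dsum M) i by rewrite rx.
  by rewrite dsum_sumE.
have [s sP] := choice (fun k => dsum_finsupp (x k)).
pose S := undup (flatten [seq s k | k <- enum K]).
have -> : x = fun k => \sum_(i <- S) dsum_in (x k i).
  apply/funext => k; apply: dsum_decomp; first exact: undup_uniq.
  move=> i iS; apply: sP; apply: contra iS => si; rewrite mem_undup.
  apply/flattenP; exists (s k) => //; apply: map_f; exact: mem_enum.
apply: trivial_relation_sum => i.
exact/(trivial_relation_map (dsum_in (i := i)))/flM.
Qed.

(** Equational flatness of [F / K] written inside [F], a form that passes to unions of chains. *)
Definition flat_quotient (F : lmodType R) (K : set F) : Prop :=
  forall (I : finType) (r : I -> R) (x : I -> F), K (\sum_i r i *: x i) ->
    exists x' : I -> F, trivial_relation r x' /\ forall i, K (x i - x' i).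

(** Only the vectors [y] are lifted; the matrix [c] is kept. *)
Lemma trivial_relation_preimage (F Q : lmodType R) (p : {linear F -> Q})
    (I : finType) (r : I -> R) (x : I -> Q) : surjective_fun p ->
  trivial_relation r x ->
  exists x' : I -> F, trivial_relation r x' /\ forall i, p (x' i) = x i.
Proof.
move=> /choice[s ps] [J [c [y [xE rc]]]].
exists (fun i => \sum_j c i j *: s (y j)); split; first by exists J, c, (s \o y).
move=> i; rewrite xE linear_sum; apply: eq_bigr => j _.
by rewrite linearZ ps.
Qed.

Lemma flat_quotientP (F Q : lmodType R) (p : {linear F -> Q}) (K : set F) :
  surjective_fun p -> (forall x, p x = 0 <-> K x) ->
  flat_quotient K <-> equationally_flat Q.
Proof.
move=> ps pK; split=> fl I r x rx.
  have [s sE] := choice ps; have [|x' [tx' xx']] := fl I r (s \o x).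
    apply/pK; rewrite linear_sum -[RHS]rx; apply: eq_bigr => i _.
    by rewrite linearZ /= sE.
  rewrite [X in trivial_relation _ X](_ : _ = fun i => p (x' i)).
    exact: trivial_relation_map.
  apply/funext => i; apply/eqP; rewrite -[x i]sE -subr_eq0 -linearB.
  by apply/eqP/pK; apply: xx'.
have rpx : \sum_i r i *: (p \o x) i = 0.
  rewrite -[RHS]((pK _).2 rx) linear_sum; apply: eq_bigr => i _.
  by rewrite linearZ.
have [x' [tx' xE]] := trivial_relation_preimage ps (fl I r (p \o x) rpx).
by exists x'; split=> // i; apply/pK; rewrite linearB xE subrr.
Qed.

(** Subtracting a solution [k] in [P] from [x] leaves a genuine relation in [F], which is trivial
    there. *)
Lemma pure_flat_quotient (F : lmodType R) (P : set F) : equationally_flat F ->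
  (forall n (r : 'I_n -> R) (x : 'I_n -> F), P (\sum_i r i *: x i) ->
     exists2 k : 'I_n -> F, (forall i, P (k i)) &
       \sum_i r i *: k i = \sum_i r i *: x i) ->
  flat_quotient P.
Proof.
move=> flF pure I r x.
have sumE (G : I -> F) : \sum_i G i = \sum_(j < #|I|) G (enum_val j).
  by rewrite -big_enum_val.
rewrite sumE => /pure[k kP rk].
pose k' i := k (enum_rank i).
exists (fun i => x i - k' i); split=> [|i]; last first.
  by rewrite opprB addrC subrK; apply: kP.
apply: flF; under eq_bigr do rewrite scalerBr.
rewrite sumrB !sumE -rk; apply/eqP; rewrite subr_eq0; apply/eqP.
by apply: eq_bigr => j _; rewrite /k' enum_valK.
Qed.

End EquationallyFlatClosure.

(** [Zorn_bigcup] also asks for the empty chain. It is applied to the sets [X] whose union with [A0]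
    satisfies [P], for which the empty chain amounts to [P A0]. *)
Lemma Zorn_above (T : Type) (P : set (set T)) (A0 : set T) : P A0 ->
  (forall C : set (set T), (forall X, C X -> P X) -> total_on C subset ->
     (exists X, C X) -> P (\bigcup_(X in C) X)%classic) ->
  exists A, [/\ P A, (A0 `<=` A)%classic &
    forall B, P B -> (A `<=` B)%classic -> (B `<=` A)%classic].
Proof.
move=> PA0 chain.
have [C CP Ctot|A [PA maxA]] := @Zorn_bigcup T (fun X => P (A0 `|` X)%classic).
  have [[X CX]|C0] := pselect (exists X, C X); last first.
    rewrite [X in (_ `|` X)%classic](_ : _ = set0) ?setU0 //.
    by apply/seteqP; split=> // x [X CX _]; apply: C0; exists X.
  rewrite [X in P X](_ : _ =
    \bigcup_(Y in [set A0 `|` X | X in C]%classic) Y)%classic.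
    apply: chain => [_ [Y CY <-]|_ _ [Y CY <-] [Z CZ <-]|]; first exact: CP.
      by have [YZ|ZY] := Ctot _ _ CY CZ; [left|right]; apply: setUS.
    by exists (A0 `|` X)%classic; exists X.
  apply/seteqP; split=> x.
    move=> [A0x|[Y CY Yx]]; first by exists (A0 `|` X)%classic; [exists X|left].
    by exists (A0 `|` Y)%classic; [exists Y|right].
  by move=> [_ [Y CY <-] [A0x|Yx]]; [left|right; exists Y].
exists (A0 `|` A)%classic; split=> [//|x A0x|B PB AB]; first by left.
have [BA|BA] := pselect (B `<=` A)%classic.
  by apply: subset_trans BA (@subsetUr _ _ _).
have /maxA[] : (A `<` B)%classic.
  by split=> //; apply: subset_trans AB; apply: subsetUr.
by rewrite (setUidPr _ _).2 //; apply: subset_trans AB; apply: subsetUl.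
Qed.

(** * Existence of flat precovers *)

Section PureSubmodule.
Variable R : pzRingType.

(** Names for the elements of a submodule generated by one element and by solutions of equations:
    [TBase r t] and [TSol r t i] stand for the parts of a decomposition of [t] as a named base plus
    [\sum_i r i *: x i]. *)
Inductive term : Type :=
| TGen
| TAdd of term & term
| TScale of R & term
| TBase n of ('I_n -> R) & term
| TSol n of ('I_n -> R) & term & 'I_n.

(* Trees over [N] name the elements of a subset [S] of any module [F] over [N]:
   a node is the type (the equations [E] and the images [nu] in [N]) of a copy
   of [term] in [F] over the elements named by the children in [D]. *)
Inductive type_tree (N : Type) : Type :=
| TLeaf
| TNode of (term -> term -> Prop) & (term -> N) & (term -> Prop)
    & (term -> type_tree N) & term.

Section InModule.
Variables (N F : lmodType R) (phi : {linear F -> N}).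

Definition term_linear (e : term -> F) : Prop :=
  (forall t u, e (TAdd t u) = e t + e u) /\
  (forall a t, e (TScale a t) = a *: e t).

(** When [E] is equality of values under another linear evaluation, the condition on [E] makes [e] a
    homomorphism out of the module of those values. *)
Definition realizes (E : term -> term -> Prop) (nu : term -> N)
    (D : term -> Prop) (v : term -> F) (e : term -> F) : Prop :=
  [/\ term_linear e, forall t u, E t u -> e t = e u,
      forall t, phi (e t) = nu t & forall t, D t -> e t = v t].

(** The choice of a realization does not see [t0], so nodes that differ only in [t0] read off values
    of one and the same copy. Nodes without a realization get the value 0. *)
Fixpoint tree_eval (w : type_tree N) : F :=
  match w with
  | TLeaf => 0
  | TNode E nu D b t0 =>
      match pselect (exists e, realizes E nu D (fun t => tree_eval (b t)) e) with
      | left h => sval (cid h) t0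
      | right _ => 0
      end
  end.

Definition named (x : F) : Prop := exists w, tree_eval w = x.

(** The set of named elements is closed under realization: the nodes over names of the [v t], one
    for each term, together evaluate to the chosen realization. *)
Lemma realizes_named E nu D (v e : term -> F) :
  (forall t, D t -> named (v t)) -> realizes E nu D v e ->
  exists2 e', realizes E nu D v e' & forall t, named (e' t).
Proof.
move=> Dv re; have bP t : exists w, D t -> tree_eval w = v t.
  have [/Dv[w wE]|nD] := pselect (D t); first by exists w.
  by exists (TLeaf N).
have [b bE] := choice bP.
have ex : exists e, realizes E nu D (fun t => tree_eval (b t)) e.
  by exists e; case: re => *; split=> // t Dt; rewrite bE //; auto.
pose e' t := tree_eval (TNode E nu D b t).
have e'E : exists2 e1, realizes E nu D (fun t => tree_eval (b t)) e1 & e' =1 e1.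
  rewrite /e' /=; case: pselect => [h|[]//].
  by case: (cid h) => e1 h1; exists e1.
case: e'E => e1 [lin1 E1 nu1 D1] e'E; exists e1.
  by split=> // t Dt; rewrite D1 // bE.
by move=> t; exists (TNode E nu D b t); apply: e'E.
Qed.

Variable m : F.

(** [TBase r t] and [TSol r t i] take the components of one chosen decomposition, and 0 when there
    is none. *)
Fixpoint term_eval (t : term) : F :=
  match t with
  | TGen => m
  | TAdd t u => term_eval t + term_eval u
  | TScale a t => a *: term_eval t
  | TBase n r t =>
      match pselect (exists p : F * ('I_n -> F),
        named p.1 /\ term_eval t = p.1 + \sum_i r i *: p.2 i) with
      | left h => (sval (cid h)).1
      | right _ => 0
      end
  | TSol n r t i =>
      match pselect (exists p : F * ('I_n -> F),
        named p.1 /\ term_eval t = p.1 + \sum_i r i *: p.2 i) with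
      | left h => (sval (cid h)).2 i
      | right _ => 0
      end
  end.

Lemma term_eval_witness n (r : 'I_n -> R) (t : term) (s : F) (x : 'I_n -> F) :
  named s -> term_eval t = s + \sum_i r i *: x i ->
  named (term_eval (TBase r t)) /\
  term_eval t = term_eval (TBase r t) + \sum_i r i *: term_eval (TSol r t i).
Proof.
move=> Ss tE; rewrite /=; case: pselect => [h|[]]; last by exists (s, x).
by case: (cid h).
Qed.

(** Written as a single term, the decomposition of [t] becomes one of the equations in [E];
    [TScale 0 TGen] serves as zero. *)
Definition term_sol n (r : 'I_n -> R) (t : term) : term :=
  TAdd (TBase r t)
    (foldr (fun i => TAdd (TScale (r i) (TSol r t i))) (TScale 0 TGen)
       (index_enum 'I_n)).

Lemma term_solE e n (r : 'I_n -> R) t : term_linear e ->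
  e (term_sol r t) = e (TBase r t) + \sum_i r i *: e (TSol r t i).
Proof.
move=> [eD eZ]; rewrite eD; congr (_ + _).
elim: (index_enum 'I_n) => [|i s IH] /=; first by rewrite big_nil eZ scale0r.
by rewrite big_cons eD eZ IH.
Qed.

(* If [S] misses [m], the submodule [A] generated by [m] and witnesses has a
   copy [f : A -> S] over [A `&` S] and over [N]; then [{a - f a}] is pure. *)
Lemma pure_submodule_in_kernel : ~ named m ->
  exists P : set F, [/\ is_submodule P, forall x, P x -> phi x = 0,
    exists2 x, P x & x != 0 &
    forall n (r : 'I_n -> R) (x : 'I_n -> F), P (\sum_i r i *: x i) ->
     exists2 k : 'I_n -> F, (forall i, P (k i)) &
       \sum_i r i *: k i = \sum_i r i *: x i].
Proof.
move=> Sm; pose e := term_eval.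
have le : term_linear e by [].
have [//||e' [[eD' eZ'] E' phi' D'] Se'] := @realizes_named (fun t u => e t = e u)
  (fun t => phi (e t)) (fun t => named (e t)) e e; first by split.
exists (fun x => exists t, x = e t - e' t); split.
- split; first by exists (TScale 0 TGen); rewrite eZ' /= !scale0r subr0.
  move=> a _ _ [t ->] [u ->]; exists (TAdd (TScale a t) u).
  by rewrite eD' eZ' /= scalerBr opprD addrACA.
- by move=> _ [t ->]; rewrite linearB phi' subrr.
- exists (m - e' TGen); first by exists TGen.
  by rewrite subr_eq0; apply/eqP => mE; apply: Sm; rewrite mE.
move=> n r x [t rx].
(* As [e' t] is named, a decomposition of [e t] has been chosen. The copy [e'] preserves it and
   fixes its named base, so the difference of the two decompositions solves the equation inside the
   submodule. *)
have tE : e t = e' t + \sum_i r i *: x i by rewrite rx addrC subrK.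
have [SB] := term_eval_witness (Se' t) tE; rewrite -!/(e _) => {}tE.
have tE' : e' t = e' (TBase r t) + \sum_i r i *: e' (TSol r t i).
  by rewrite -term_solE //; apply: E'; rewrite term_solE.
exists (fun i => e (TSol r t i) - e' (TSol r t i)) => [i|].
  by exists (TSol r t i).
under eq_bigr do rewrite scalerBr.
by rewrite sumrB rx tE tE' D' // opprD addrACA subrr add0r.
Qed.

End InModule.

(** Take [K] maximal among the submodules of the kernel of [phi] with flat quotient. An unnamed
    element of [F / K] would give a nonzero pure submodule in the kernel of the induced map, whose
    preimage would enlarge [K]. So [type_tree N], which does not depend on [F], names all of
    [F / K]. *)
Lemma flat_small_quotient (N F : lmodType R) (phi : {linear F -> N}) :
  equationally_flat F ->
  exists K : set F, [/\ is_submodule K, forall x, K x -> phi x = 0,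
    flat_quotient K &
    exists s : type_tree N -> F, forall x, exists w, K (x - s w)].
Proof.
move=> flF.
pose good (K : set F) :=
  [/\ is_submodule K, forall x, K x -> phi x = 0 & flat_quotient K].
have good0 : good [set 0]%classic.
  split=> [|x ->|]; last 2 first.
  - by rewrite linear0.
  - move=> I r x /= rx; exists x; split=> [|i]; last exact: subrr.
    exact: flF.
  by split=> // a x y -> ->; rewrite scaler0 addr0.
have [|K [[Ks Kphi flK] _ maxK]] := Zorn_above good0.
  move=> C Cgood Ctot C0; split.
  - by apply: bigcup_chain_is_submodule => // X /Cgood[].
  - by move=> x [X /Cgood[_ h _] /h].
  - move=> I r x [X CX Xx]; case: (Cgood _ CX) => _ _ /(_ _ _ _ Xx)[x' [tx' xx']].
    by exists x'; split=> // i; exists X.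
exists K; split=> //.
pose p := quotient_pi Ks.
have pS : surjective_fun p by apply: quotient_pi_surj.
have pK x : p x = 0 <-> K x by apply: quotient_pi_eq0.
have [|psi psiE] := linear_factor (h := phi) pS; first by move=> x /pK /Kphi.
have flQ : equationally_flat (quotient_of_set Ks) by apply/(flat_quotientP pS pK).
have [Qnamed|] := pselect (forall q, named psi q).
  have [l lP] := choice pS; exists (fun w => l (tree_eval psi w)) => x.
  have [w wE] := Qnamed (p x); exists w; apply/pK.
  by rewrite linearB lP wE subrr.
move=> /existsNP[q /pure_submodule_in_kernel[P [Ps Ppsi [q0 Pq0 q0N] Ppure]]].
have flP := pure_flat_quotient flQ Ppure.
case/negP: q0N; have [x0 x0E] := pS q0; apply/eqP; rewrite -x0E; apply/pK.
apply: (maxK (fun x => P (p x))); last first.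
- by rewrite x0E.
- by move=> x /pK ->; case: Ps.
split.
- split=> [|a x y Px Py]; first by rewrite linear0; case: Ps.
  by rewrite linearP; case: Ps => _; apply.
- by move=> x /Ppsi; rewrite psiE.
move=> I r x; rewrite linear_sum => rx.
have [|x' [tx' xx']] := flP I r (p \o x).
  by under eq_bigr do rewrite -linearZ.
have [x'' [tx'' x''E]] := trivial_relation_preimage pS tx'.
by exists x''; split=> // i; rewrite linearB x''E; apply: xx'.
Qed.

Theorem flat_precover_exists (N : lmodType R) :
  exists (G : lmodType R) (g : {linear G -> N}), flat_precover g.
Proof.
pose U : lmodType R := free_module R {classic type_tree N}.
(* A flat quotient of [U] over [N] is recorded by its kernel and by the composite from [U] to [N],
   so that the index type does not quantify over modules. *)
pose I := {p : set U * (U -> N) |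
  [/\ is_submodule p.1, flat_quotient p.1, linear p.2 &
      forall x, p.1 x -> p.2 x = 0]}.
have Is (i : I) : is_submodule (sval i).1 by case: i => p [].
pose Q (i : {classic I}) : lmodType R := quotient_of_set (Is i).
pose q (i : {classic I}) : {linear U -> Q i} := quotient_pi (Is i).
have qS i : surjective_fun (q i) by apply: quotient_pi_surj.
have qK (i : {classic I}) x : q i x = 0 <-> (sval i).1 x by apply: quotient_pi_eq0.
have hP (i : {classic I}) : exists h : {linear Q i -> N}, forall x,
    h (q i x) = (sval i).2 x.
  case: (svalP i) => _ _ /linear_exists[f fE] f0.
  have [|h hE] := linear_factor (h := f) (qS i).
    by move=> x /qK /f0; rewrite fE.
  by exists h => x; rewrite hE fE.
have [g gE] := dsum_lift_linear (fun i => projT1 (cid (hP i))).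
have {}gE i x : g (dsum_in (q i x)) = (sval i).2 x.
  by rewrite gE; case: (cid (hP i)).
exists (dsum Q), g; split.
  apply/equationally_flat_flat/dsum_equationally_flat => i.
  apply/(flat_quotientP (qS i) (qK i)); by case: (svalP i).
move=> F f /flat_equationally_flat /(flat_small_quotient f)[K [Ks Kf flK [s sK]]].
pose p := quotient_pi Ks.
have pS : surjective_fun p by apply: quotient_pi_surj.
have pK x : p x = 0 <-> K x by apply: quotient_pi_eq0.
have [|f' f'E] := linear_factor (h := f) pS; first by move=> x /pK /Kf.
have [u uE] := free_lift (fun w : {classic type_tree N} => p (s w)).
have uS : surjective_fun u.
  move=> y; have [x <-] := pS y; have [w wE] := sK x.
  exists (free_gen R (w : {classic type_tree N})).
  by rewrite uE; apply/esym/eqP; rewrite -subr_eq0 -linearB; apply/eqP/pK.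
pose K0 : set U := fun x => u x = 0.
have iP : [/\ is_submodule K0, flat_quotient K0, linear (f' \o u) &
      forall x, K0 x -> (f' \o u) x = 0].
  split.
  - split; first exact: linear0.
    by move=> a x y /= xE yE; rewrite /K0 linearP xE yE scaler0 addr0.
  - apply/(flat_quotientP uS); first by [].
    by apply/(flat_quotientP pS).
  - by move=> a x y /=; rewrite !linearP.
  - by move=> x /= ->; rewrite linear0.
pose i : {classic I} := exist _ (K0, _) iP.
(* Since [u] and [q i] have the same kernel, [v] is an isomorphism from [F / K] to the summand
   [Q i]. The lift of [f] is the projection, then [v], then the inclusion of the summand. *)
have [|v vE] := linear_factor (h := q i) uS; first by move=> x; apply: (qK i x).2.
have [h hE] := @linear_exists _ _ _ (fun x => dsum_in (v (p x)) : dsum Q)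
  (fun a x y => etrans (congr1 (fun z => dsum_in (v z)) (linearP p a x y))
     (etrans (congr1 (@dsum_in _ _ _ i) (linearP v a _ _)) (dsum_in_linear a _ _))).
exists h => x; rewrite hE; have [y yE] := uS (p x).
by rewrite -yE vE gE /= yE f'E.
Qed.

End PureSubmodule.

(** * Characters and injective modules *)

Definition QmodZ_pi (x : rat) : QmodZ := (\pi_(@Quotient.quot rat rat_intb) x)%qT.

Lemma QmodZ_pi_is_zmod_morphism : zmod_morphism QmodZ_pi.
Proof. by move=> x y; rewrite /QmodZ_pi [LHS]raddfB. Qed.
HB.instance Definition _ :=
  GRing.isZmodMorphism.Build rat QmodZ QmodZ_pi QmodZ_pi_is_zmod_morphism.

Lemma QmodZ_pi_surj q : exists x, QmodZ_pi x = q.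
Proof.
by exists (repr (q : @Quotient.quot rat rat_intb)); rewrite /QmodZ_pi reprK.
Qed.

Lemma QmodZ_pi_eq0 x : (QmodZ_pi x == 0) = (x \is a Num.int).
Proof.
rewrite -[RHS]/(x \in rat_intb) -[x in RHS]subr0 Quotient.idealrBE.
by rewrite -/(QmodZ_pi 0) raddf0.
Qed.

(** Two roots that differ by the class of [1 / n] cannot both vanish when [n > 1]. The nonzero
    choice is what lets characters separate points. *)
Lemma QmodZ_divisible n (q : QmodZ) : (0 < n)%N ->
  exists q' : QmodZ, q' *+ n = q /\ ((1 < n)%N -> q' != 0).
Proof.
move=> n0; have [x <-] := QmodZ_pi_surj q.
have nN0 : n%:R != 0 :> rat by rewrite pnatr_eq0 -lt0n.
have divK (y : rat) : QmodZ_pi (y / n%:R) *+ n = QmodZ_pi y.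
  by rewrite -raddfMn -[_ *+ n]mulr_natr divfK.
have [/eqP x0|x0] := boolP (QmodZ_pi (x / n%:R) == 0); last first.
  by exists (QmodZ_pi (x / n%:R)); rewrite divK.
exists (QmodZ_pi ((x + 1) / n%:R)); rewrite divK; split.
  apply/eqP; rewrite -subr_eq0 -raddfB /= QmodZ_pi_eq0 addrC addKr.
  exact: rpred1.
move=> n1; rewrite mulrDl raddfD /= x0 add0r QmodZ_pi_eq0 mul1r.
apply/negP => /intrP[k kE].
have : 0 < (k%:~R : rat) < 1 by rewrite -kE invr_gt0 ltr0n n0 invf_lt1 ?ltr1n ?ltr0n.
rewrite ltr0z -[1]/(1%:~R) ltr_int => /andP[k0 k1].
by move: k1; rewrite ltNge -gtz0_ge1 k0.
Qed.

Section Characters.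
Variable B : zmodType.

(* Additive maps from a subgroup of [B] to [Q/Z], as graphs. *)
Definition character_graph (G : set (B * QmodZ)) : Prop :=
  [/\ G (0, 0), forall x p y q, G (x, p) -> G (y, q) -> G (x - y, p - q) &
      forall q, G (0, q) -> q = 0].

Lemma character_graphN G x p : character_graph G -> G (x, p) -> G (- x, - p).
Proof. by move=> [G0 GB _] Gx; rewrite -[- x]sub0r -[- p]sub0r; apply: GB. Qed.

Lemma character_graphD G x p y q : character_graph G ->
  G (x, p) -> G (y, q) -> G (x + y, p + q).
Proof.
move=> Gg Gx Gy; rewrite -[y]opprK -[q]opprK; have [_ GB _] := Gg.
by apply: GB => //; apply: character_graphN.
Qed.

Lemma character_graphMz G x p (k : int) : character_graph G ->
  G (x, p) -> G (x *~ k, p *~ k).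
Proof.
move=> Gg Gx; have Gn n : G (x *+ n, p *+ n).
  elim: n => [|n IH]; first by case: Gg.
  by rewrite !mulrS; apply: character_graphD.
by case: k => n; [apply: Gn | apply: character_graphN => //; apply: Gn].
Qed.

(** If some positive multiple of [b] is in the domain of [G], take the least such [n] and divide the
    value at [b *+ n] by [n]. For [b] outside the domain [n > 1], so the result can be chosen
    nonzero. *)
Lemma character_graph_value G b : character_graph G ->
  exists q' : QmodZ, (forall (k : int) q, G (b *~ k, q) -> q = q' *~ k) /\
    ((forall q, ~ G (b, q)) -> q' != 0).
Proof.
move=> Gg; have [_ GB Gfun] := Gg.
pose D n := (0 < n)%N && `[< exists q, G (b *+ n, q) >].
have [Dn|nD] := pselect (exists n, D n); last first.
  (* With no positive multiple of [b] in the domain, any value is allowed at [b]; a nonzero half of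
     0 is taken. *)
  have [q' [_ /(_ isT) q'N]] := @QmodZ_divisible 2 0 isT.
  exists q'; split=> // k q Gk.
  have Gabs : G (b *+ `|k|%N, q *~ Num.sg k).
    by have := character_graphMz (Num.sg k) Gg Gk; rewrite -mulrzA mulrC -abszEsg.
  have [/eqP|k0] := posnP `|k|%N.
    by rewrite absz_eq0 => /eqP k0; move: Gk; rewrite k0 !mulr0z => /Gfun.
  by case: nD; exists `|k|%N; rewrite /D k0; apply/asboolP; exists (q *~ Num.sg k).
case: (ex_minnP Dn) => n /andP[n0 /asboolP[q0 Gq0]] nmin.
have [q' [q'n q'N]] := QmodZ_divisible q0 n0.
exists q'; split=> [k q Gk|bG]; last first.
  apply: q'N; rewrite ltn_neqAle n0 andbT; apply/eqP => n1.
  by apply: (bG q0); move: Gq0; rewrite -n1 mulr1n.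
pose d := (k %/ n)%Z; pose r := `|(k %% n)%Z|%N.
have rE : (k %% n)%Z = r by rewrite gez0_abs // modz_ge0 // eqz_nat -lt0n.
have kE : k = d * n%:Z + r%:Z by rewrite -rE -divz_eq.
have Gr : G (b *+ r, q - q0 *~ d).
  have := GB _ _ _ _ Gk (character_graphMz d Gg Gq0).
  rewrite [X in G (X, _)](_ : _ = b *+ r) // kE mulrzDr mulrC mulrzA addrC.
  by rewrite -!pmulrn addKr.
have r0 : r = 0%N.
  apply/eqP; apply: contraT => rN0.
  have : (n <= r)%N.
    by apply: nmin; rewrite /D lt0n rN0; apply/asboolP; exists (q - q0 *~ d).
  by rewrite leqNgt -ltz_nat -rE ltz_pmod.
move: Gr; rewrite r0 mulr0n => /Gfun/eqP; rewrite subr_eq0 => /eqP ->.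
by rewrite kE r0 addr0 mulrC mulrzA -pmulrn q'n.
Qed.

Lemma character_graph_step G b : character_graph G ->
  exists (G' : set (B * QmodZ)) (q' : QmodZ),
    [/\ character_graph G', (G `<=` G')%classic, G' (b, q') &
        (forall q, ~ G (b, q)) -> q' != 0].
Proof.
move=> Gg; have [q' [q'E q'N]] := character_graph_value b Gg.
have [G0 GB _] := Gg.
exists (fun z => exists x p (k : int),
  G (x, p) /\ z = (x + b *~ k, p + q' *~ k)), q'.
split=> //.
- split.
  + by exists 0, 0, 0; rewrite !mulr0z !addr0.
  + move=> x p y q [x' [p' [k [Gx' [-> ->]]]]] [y' [r' [l [Gy' [-> ->]]]]].
    exists (x' - y'), (p' - r'), (k - l); split; first exact: GB.
    by congr pair; rewrite mulrzBr opprD addrACA.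
  + move=> q [x [p [k [Gx [/esym/eqP xE ->]]]]].
    have := character_graphN Gg Gx.
    rewrite (_ : - x = b *~ k) => [/q'E <-|]; first exact: subrr.
    by apply/eqP; rewrite eq_sym -addr_eq0 addrC.
- by move=> [x p] Gx; exists x, p, 0; rewrite !mulr0z !addr0.
- by exists 0, 0, 1; rewrite !mulr1z !add0r.
Qed.

Lemma character_graph_extend G : character_graph G ->
  exists2 chi : B -> QmodZ, zmod_morphism chi & forall x p, G (x, p) -> chi x = p.
Proof.
move=> Gg; have [|G1 [G1g GG1 maxG1]] := Zorn_above Gg.
  move=> C Cg Ctot [X0 CX0]; split.
  - by exists X0 => //; case: (Cg _ CX0).
  - move=> x p y q [X CX Xx] [Y CY Yy].
    have [XY|YX] := Ctot _ _ CX CY.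
      by exists Y => //; case: (Cg _ CY) => _ h _; apply: h => //; apply: XY.
    by exists X => //; case: (Cg _ CX) => _ h _; apply: h => //; apply: YX.
  - by move=> q [X /Cg[_ _ h] /h].
have tot b : exists q, G1 (b, q).
  have [G' [q' [G'g GG' G'b _]]] := character_graph_step b G1g.
  by exists q'; apply: (maxG1 G').
have [chi chiP] := choice tot; have [_ G1B G1fun] := G1g.
have uniq_val x p : G1 (x, p) -> chi x = p.
  move=> Gx; have := G1B _ _ _ _ (chiP x) Gx; rewrite subrr => /G1fun/eqP.
  by rewrite subr_eq0 => /eqP.
exists chi => [x y|x p /GG1]; last exact: uniq_val.
by apply: uniq_val; apply: G1B.
Qed.

Lemma character_separates b : b != 0 ->
  exists2 chi : B -> QmodZ, zmod_morphism chi & chi b != 0.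
Proof.
move=> b0; pose G : set (B * QmodZ) := [set (0, 0)]%classic.
have Gg : character_graph G.
  split=> //; first by move=> x p y q [-> ->] [-> ->]; rewrite !subrr.
  by move=> q [].
have [G' [q' [G'g GG' G'b q'N]]] := character_graph_step b Gg.
have [chi chiB chiE] := character_graph_extend G'g; exists chi => //.
rewrite (chiE _ _ G'b); apply: q'N => q [bE _].
by move: b0; rewrite bE eqxx.
Qed.

End Characters.

Lemma character_extend (A B : zmodType) (i : {additive A -> B}) (chi : A -> QmodZ) :
  injective i -> zmod_morphism chi ->
  exists2 chi' : B -> QmodZ, zmod_morphism chi' & forall a, chi' (i a) = chi a.
Proof.
move=> iI chiB; pose G : set (B * QmodZ) := fun z => exists a, z = (i a, chi a).
have chi0 : chi 0 = 0 by rewrite -[0 in LHS](subrr 0) chiB subrr.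
have [|chi' chi'B chi'E] := @character_graph_extend _ G.
  split; first by exists 0; rewrite raddf0 chi0.
    move=> x p y q [a [-> ->]] [b [-> ->]]; exists (a - b).
    by rewrite raddfB chiB.
  move=> q [a [a0 ->]]; rewrite [a](_ : _ = 0) //.
  by apply: iI; rewrite raddf0.
by exists chi' => // a; apply: chi'E; exists a.
Qed.

Section CharacterModules.
Variable R : pzRingType.

(** Maps from [A] to [charmod F] are characters of [tensor F A], which flatness embeds in
    [tensor F B]; characters extend along embeddings. *)
Lemma charmod_injective (F : lmodType R^c) :
  right_flat F -> injective_module (charmod F).
Proof.
move=> flF A B i f iI.
have [|||chi [chiB chiE]] := @tensor_lift R F A QmodZ (fun x a => val (f a) x).
- by move=> x y a; rewrite charmodD.
- by move=> x a b; rewrite linearD.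
- by move=> r x a; rewrite linearZ.
have [chi' chi'B chi'E] := character_extend (flF _ _ i iI) chiB.
pose chi'' : {additive tensor F B -> QmodZ} :=
  HB.pack chi' (GRing.isZmodMorphism.Build _ _ chi' chi'B).
have chi'D x y : chi' (x + y) = chi' x + chi' y := raddfD chi'' x y.
have gP b : (fun x => chi' (tens x b)) \in @is_character R F.
  by apply/asboolP => x y; rewrite tensBl chi'B.
have [|g gE] := @linear_exists _ B (charmod F) (fun b => SigSub (gP b)).
  move=> a b b'; apply/val_inj/funext => x /=.
  by rewrite !fctE /= tensDr chi'D -tensM.
exists g => a; apply/val_inj/funext => x; rewrite gE /=.
by rewrite -[RHS]chiE -chi'E; congr chi'; apply/esym/tensor_map_tens.
Qed.

(** An element of the tensor product is the sum of the generators tensored with its coordinates in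
    [A]; applying [i] acts on each coordinate separately, so injectivity of [i] suffices. *)
Lemma free_right_flat (T : choiceType) : right_flat (free_module R^c T).
Proof.
move=> A B i iI; apply: raddf_inj => z; have [s ->] := tensor_sum_tens z.
rewrite raddf_sum => iz.
have coord0 t : \sum_(p <- s) (p.1 t : R) *: p.2 = 0.
  have [|||ev [evB evE]] := @tensor_lift R (free_module R^c T) B B
      (fun f b => (f t : R) *: b).
  - by move=> f g b; rewrite -scalerDl.
  - by move=> f b c; rewrite scalerDr.
  - by move=> r f b; rewrite scalerA.
  pose ev' : {additive tensor (free_module R^c T) B -> B} :=
    HB.pack ev (GRing.isZmodMorphism.Build _ _ ev evB).
  apply: iI; rewrite linear_sum linear0; transitivity (ev' 0); last exact: raddf0.
  rewrite -iz raddf_sum; apply: eq_bigr => p _.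
  rewrite linearZ -[LHS](evE p.1 (i p.2)).
  by congr ev; apply/esym/tensor_map_tens.
have [S [uS SP]] : exists S, uniq S /\
    forall p, p \in s -> forall t, t \notin S -> p.1 t = 0.
  have [l lP] := choice (fun f : free_module R^c T => dsum_finsupp f).
  exists (undup (flatten [seq l p.1 | p <- s])); split; first exact: undup_uniq.
  move=> p ps t tS; apply: lP; apply: contra tS => tl; rewrite mem_undup.
  by apply/flattenP; exists (l p.1) => //; apply: (map_f (fun p => l p.1)).
transitivity (\sum_(t <- S)
  tens (free_gen R^c t) (\sum_(p <- s) (p.1 t : R) *: p.2)); last first.
  by apply: big1 => t _; rewrite coord0 tens0r.
under [RHS]eq_bigr do rewrite tens_sumr.
rewrite exchange_big; apply: eq_big_seq => p ps /=.
rewrite {1}(dsum_decomp uS (SP p ps)) tens_suml; apply: eq_bigr => t _.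
rewrite -tensM /free_gen -linearZ; congr (tens (dsum_in _) _).
by rewrite -[RHS]/((p.1 t : R^c) * 1) mulr1.
Qed.

(** The right module is free on the characters of [M], and [j m] sends the basis vector of [chi]
    with coefficient [r] to [chi (r *: m)]. Injectivity holds because characters separate points. *)
Lemma embeds_in_character_module (M : lmodType R) :
  exists (F : lmodType R^c) (j : {linear M -> charmod F}),
    right_flat F /\ injective j.
Proof.
pose T := {classic {chi : M -> QmodZ | zmod_morphism chi}}.
pose F := free_module R^c T; exists F.
have hP (m : M) (t : T) : exists h : {additive (R^c)^o -> QmodZ},
    forall r : R, h r = sval t (r *: m).
  have hB : zmod_morphism ((fun r : R => sval t (r *: m)) : (R^c)^o -> QmodZ).
    move=> x y; rewrite -(svalP t); congr (sval t _).
    by rewrite -scalerBl.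
  exact: additive_exists hB.
pose h m t := projT1 (cid (hP m t)).
have hE m t (r : R) : h m t r = sval t (r *: m) by rewrite /h; case: (cid (hP m t)).
pose J m : F -> QmodZ := dsum_lift (h m).
have Jin m t (r : R) : J m (@dsum_in R^c T (fun=> (R^c)^o) t r) = sval t (r *: m).
  by rewrite /J dsum_lift_in hE.
have JP m : J m \in @is_character R F.
  by apply/asboolP; apply: dsum_lift_is_zmod_morphism.
have JD m f g : J m (f + g) = J m f + J m g by apply: dsum_liftD.
have svalD (t : T) x y : sval t (x + y) = sval t x + sval t y.
  have t0 : sval t 0 = 0 by rewrite -[0 in LHS](subrr 0) (svalP t) subrr.
  by rewrite -[y in LHS]opprK -[- y]sub0r !(svalP t) t0 sub0r opprK.
have J0 m : J m 0 = 0 by apply: (addrI (J m 0)); rewrite -JD !addr0.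
have [|j jE] := @linear_exists _ M (charmod F) (fun m => SigSub (JP m)).
  move=> a m m'; apply/val_inj/funext; apply: dsum_ind => /=.
  - by rewrite !fctE scaler0 !J0 addr0.
  - by move=> f g; rewrite !fctE scalerDr !JD => -> ->; rewrite addrACA.
  - move=> t r; rewrite !fctE -linearZ !Jin scalerDr svalD scalerA.
    by rewrite -[(_ *: _ : (R^c)^o)]/((r : R) * a).
exists j; split; first exact: free_right_flat.
apply: raddf_inj => m jm; apply/eqP; apply: contraT => m0.
have [chi chiB chim] := character_separates m0.
pose t : T := exist _ chi chiB.
have := Jin m t 1; rewrite scale1r /= => Jm; case/negP: chim.
rewrite -Jm -[J m]/(val (SigSub (JP m) : charmod F)) -jE jm.
by [].
Qed.

Lemma embeds_in_injective (M : lmodType R) :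
  exists (E : lmodType R) (i : {linear M -> E}), injective_module E /\ injective i.
Proof.
have [F [j [flF jI]]] := embeds_in_character_module M.
by exists (charmod F), j; split=> //; apply: charmod_injective.
Qed.

End CharacterModules.

(** * Injective envelopes *)

Section InjectiveEnvelope.
Variable R : pzRingType.

Lemma linear_corestrict (A E : lmodType R) (S : submodClosed E)
    (f : {linear A -> E}) : (forall x, f x \in S) ->
  exists g : {linear A -> submod S}, forall x, val (g x) = f x.
Proof.
move=> fS; have [|g gE] := @linear_exists _ A (submod S) (fun x => SigSub (fS x)).
  by move=> a x y; apply/val_inj; rewrite /= linearP.
by exists g => x; rewrite gE.
Qed.

(** The elementwise form of essentiality, which passes to unions of chains. *)
Definition essential_over (E : lmodType R) (M X : set E) : Prop :=
  forall x, X x -> x != 0 -> exists2 r, M (r *: x) & r *: x != 0.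

Lemma injective_submodule_retract (E : lmodType R) (S : submodClosed E)
    (rho : {linear E -> E}) : injective_module E ->
  (forall x, rho x \in S) -> (forall x, x \in S -> rho x = x) ->
  injective_module (submod S).
Proof.
move=> injE rhoS rhoE A B i f iI.
have [g gE] := injE A B i (val \o f) iI.
have [|h hE] := linear_corestrict (S := S) (f := rho \o g); first by move=> x /=.
exists h => x; apply/val_inj; rewrite hE /= gE /= rhoE //.
exact: (valP (f x)).
Qed.

(* A maximal essential extension [X] of [M] inside an injective [E] is a
   retract: if [C] is maximal with [X `&` C = 0], the inclusion of [X] extends to
   an embedding of [E / C], whose image is essential over [M], hence is [X]. *)
Lemma maximal_essential_retract (E : lmodType R) (M X : set E) :
  injective_module E -> is_submodule X -> essential_over M X ->
  (forall Y, is_submodule Y -> essential_over M Y ->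
     (X `<=` Y)%classic -> (Y `<=` X)%classic) ->
  exists rho : {linear E -> E},
    (forall x, X (rho x)) /\ (forall x, X x -> rho x = x).
Proof.
move=> injE Xs Xess Xmax.
pose indep (C : set E) := is_submodule C /\ forall x, X x -> C x -> x = 0.
have indep0 : indep [set 0]%classic.
  by split=> //; split=> // a x y -> ->; rewrite scaler0 addr0.
have [|C [[Cs CX] _ Cmax]] := Zorn_above indep0.
  move=> D Dg Dtot D0; split; last by move=> x Xx [Y /Dg[_ h] /h]; apply.
  by apply: bigcup_chain_is_submodule => // Y /Dg[].
have [C0 CP] := Cs.
pose p := quotient_pi Cs.
have pS : surjective_fun p by apply: quotient_pi_surj.
have pK x : p x = 0 <-> C x by apply: quotient_pi_eq0.
(* By maximality of [C], the submodule generated by [C] and [y] meets [X] nontrivially; so the image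
   of [X] is essential in [E / C]. *)
have pess y : p y != 0 -> exists r x, [/\ X x, x != 0 & r *: p y = p x].
  move=> py; apply: contrapT => no.
  case/negP: py; apply/eqP/pK.
  apply: (Cmax (fun z => exists c r, C c /\ z = c + r *: y)); last first.
  - by exists 0, 1; rewrite scale1r add0r.
  - by move=> c Cc; exists c, 0; rewrite scale0r addr0.
  split.
    split; first by exists 0, 0; rewrite scale0r addr0.
    move=> a _ _ [c [r [Cc ->]]] [d [s [Cd ->]]].
    exists (a *: c + d), (a * r + s); split; first exact: CP.
    by rewrite scalerDr scalerDl scalerA addrACA.
  move=> x Xx [c [r [Cc xE]]].
  apply/eqP; apply: contraT => x0; case: no; exists r, x; split=> //.
  by rewrite xE linearD linearZ (pK c).2 // add0r.
pose S := submodClosed_of_set Xs; have SE := submodClosed_of_setP Xs.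
have vX (x : submod S) : X (val x) by apply/SE; apply: (valP x).
have [|g gE] := injE (submod S) _ (p \o val) (val : {linear submod S -> E}).
  apply: raddf_inj => x /= px; apply/val_inj/CX; first exact: vX.
  exact/pK.
have {}gE x : X x -> g (p x) = x.
  by move=> Xx; have /SE xS := Xx; rewrite -[RHS](gE (SigSub xS)).
have gX : forall x, X (g (p x)).
  move=> x; apply: (Xmax (fun z => exists q, z = g q)); last by exists (p x).
  - split; first by exists 0; rewrite linear0.
    by move=> a _ _ [u ->] [v ->]; exists (a *: u + v); rewrite linearP.
  - move=> _ [q ->]; have [y <-] := pS q => gy0.
    have [|r [z [Xz z0 rE]]] := pess y.
      by apply: contraNneq gy0 => ->; rewrite linear0.
    have [s Ms s0] := Xess z Xz z0.
    by exists (s * r); rewrite -scalerA -linearZ /= rE gE.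
  - by move=> z Xz; exists (p z); rewrite gE.
by exists (g \o p).
Qed.

(** A maximal essential extension of [M] inside an injective module is a retract of it, hence
    injective. *)
Lemma injective_envelope_exists (M : lmodType R) :
  exists (E : lmodType R) (i : {linear M -> E}), injective_envelope i.
Proof.
have [N [i [injN iI]]] := embeds_in_injective M.
pose M' : set N := fun y => exists x, y = i x.
pose ext (X : set N) := is_submodule X /\ essential_over M' X.
have extM : ext M'.
  split; last by move=> x M'x x0; exists 1; rewrite scale1r.
  split; first by exists 0; rewrite linear0.
  by move=> a _ _ [x ->] [y ->]; exists (a *: x + y); rewrite linearP.
have [|X [[Xs Xess] M'X Xmax]] := Zorn_above extM.
  move=> D Dg Dtot D0; split; last by move=> x [Y /Dg[_ h] /h].
  by apply: bigcup_chain_is_submodule => // Y /Dg[].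
have [|rho [rhoX rhoE]] := maximal_essential_retract injN Xs Xess.
  by move=> Y Ys Yess; apply: Xmax.
pose S := submodClosed_of_set Xs; have SE := submodClosed_of_setP Xs.
have [|j jE] := linear_corestrict (S := S) (f := i).
  by move=> x; apply/SE/M'X; exists x.
exists (submod S), j; split.
  apply: (injective_submodule_retract (rho := rho)) => // x; first exact/SE.
  by move=> /SE; apply: rhoE.
split; first by move=> x y jxy; apply: iI; rewrite -!jE jxy.
move=> K [y Ky y0].
have [||r [x xE] r0] := Xess (val y).
- by apply/SE; apply: (valP y).
- by apply: contraNneq y0 => vy0; apply/eqP/val_inj; rewrite vy0 raddf0.
have jx : j x = r *: y by apply/val_inj; rewrite jE -xE linearZ.
exists x; rewrite jx; first exact: rpredZ.
by apply: contraNneq r0 => ry; rewrite -[r *: _]/(val (r *: y)) ry raddf0.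
Qed.

End InjectiveEnvelope.

(** * Vanishing of Ext and the equivalences *)

(** On a free resolution, [f \o e] lifts to [g] from [P0] to [E], and [g \o d1] takes values in [N].
    As a cocycle it equals [b \o d1]; then [g - b] vanishes on the kernel of [e] and descends to
    [M]. *)
Lemma Ext1_zero_lift (R : pzRingType) (M E : lmodType R) (N : submodClosed E)
    (f : {linear M -> quotmod N}) : Ext1_zero M (submod N) ->
  exists g : {linear M -> E}, forall x, quotmod_pi N (g x) = f x.
Proof.
move=> ext0.
(* The free module on all elements of a submodule maps onto it; three such covers start the
   resolution. *)
have cover (U : lmodType R) (A : set U) : is_submodule A ->
    exists (P : lmodType R) (d : {linear P -> U}),
      projective_module P /\ forall y, A y <-> exists x, d x = y.
  move=> As; pose T := {classic {x : U | A x}}.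
  have [d dE] := free_lift (fun t : T => sval t).
  exists (free_module R T), d; split; first exact: free_projective.
  move=> y; split=> [Ay|[x <-]].
    by exists (free_gen R (exist _ y Ay : T)); rewrite dE.
  elim/free_ind: x => [|u v Au Av|a t].
  - by rewrite linear0; case: As.
  - by rewrite linearD; apply: is_submoduleD.
  - by rewrite linearZ dE; apply: is_submoduleZ => //; apply: (svalP t).
have kers (U V : lmodType R) (h : {linear U -> V}) : is_submodule (fun x => h x = 0).
  split; first exact: linear0.
  by move=> a x y xE yE; rewrite linearP xE yE scaler0 addr0.
have [P0 [e [proj0 eE]]] := cover M setT (conj I (fun _ _ _ _ _ => I)).
have eS : surjective_fun e by move=> y; apply/eE.
have [P1 [d1 [proj1 d1E]]] := cover _ _ (kers _ _ e).
have [P2 [d2 [proj2 d2E]]] := cover _ _ (kers _ _ d1).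
have [g gE] := proj0 _ _ (quotmod_pi N) (f \o e) (@quotmod_pi_surj _ _ N).
have piN x : quotmod_pi N x = 0 <-> x \in N.
  rewrite -[x in x \in N]subr0 -quotmod_piE.
  have -> : quotmod_pi N 0 = 0 by apply: (raddf0 (quotmod_pi N)).
  by split=> [->|/eqP].
have [|c cE] := linear_corestrict (S := N) (f := g \o d1).
  by move=> x; apply/piN; rewrite /= gE /= (d1E _).2 ?linear0 //; exists x.
have [|x|b bE] := ext0 P0 P1 P2 e d1 d2 _ c.
- by split.
- apply/val_inj; rewrite cE /= (_ : d1 (d2 x) = 0) ?raddf0 //.
  by apply/d2E; exists x.
pose v : {linear submod N -> E} := val.
have [|g' g'E] := @linear_exists _ P0 E (fun x => g x - v (b x)).
  move=> a x y; rewrite (linearP g) (linearP b) (linearP v).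
  by rewrite scalerBr opprD addrACA.
have [|k kE] := linear_factor (h := g') eS.
  by move=> x /d1E[y <-]; rewrite g'E -bE -[v _]/(val _) cE subrr.
exists k => x; have [y <-] := eS x; rewrite kE g'E quotmod_piB gE.
by rewrite (piN (v (b y))).2 ?subr0 //; apply: (valP (b y)).
Qed.

Theorem proposition4p7 (R : pzRingType) (M : lmodType R) :
  [<-> (* (1) *)
       forall E : lmodType R, injective_module E -> fpc_domain M E;
       (* (2) *)
       forall (E : lmodType R) (i : {linear M -> E}),
         injective_envelope i -> fpc_domain M E;
       (* (3) *)
       forall F : lmodType R^c, right_flat F -> fpc_domain M (charmod F);
       (* (4) *)
       exists (F : lmodType R) (j : {linear M -> F}), flat F /\ injective j;
       (* (5) *)
       forall (E : lmodType R) (N : submodClosed E),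
         injective_module E -> Ext1_zero M (submod N) ->
         fpc_domain M (quotmod N) ].
Proof.
have embed (E : lmodType R) (i : {linear M -> E}) : injective i -> fpc_domain M E ->
    exists (F : lmodType R) (j : {linear M -> F}), flat F /\ injective j.
  move=> iI ME; have [G [g gP]] := flat_precover_exists E.
  have [h hE] := ME i G g gP; exists G, h; split; first by case: gP.
  by move=> x y hxy; apply: iI; rewrite -!hE hxy.
have h45 : (exists (F : lmodType R) (j : {linear M -> F}), flat F /\ injective j) ->
    forall (E : lmodType R) (N : submodClosed E),
      injective_module E -> Ext1_zero M (submod N) -> fpc_domain M (quotmod N).
  (* Vanishing of Ext lifts [f] to [E], injectivity of [E] extends the lift to [F], and flatness of
     [F] lifts the result through the precover. *)
  move=> [F [j [flF jI]]] E N injE ext0 f G g [flG gP].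
  have [f' f'E] := Ext1_zero_lift f ext0.
  have [k kE] := injE _ _ j f' jI.
  have [h hE] := gP F (quotmod_pi N \o k) flF.
  by exists (h \o j) => x; rewrite /= hE /= kE f'E.
have h51 : (forall (E : lmodType R) (N : submodClosed E),
      injective_module E -> Ext1_zero M (submod N) -> fpc_domain M (quotmod N)) ->
    forall E : lmodType R, injective_module E -> fpc_domain M E.
  (* Condition (5) is used with the zero submodule. The quotient of [E] by zero is another type than
     [E], so [f] and the precover are carried over along the isomorphism [p]. *)
  move=> h5 E injE f G g [flG gP].
  have Zs : is_submodule ([set 0]%classic : set E).
    by split=> // a x y -> ->; rewrite scaler0 addr0.
  pose p := quotient_pi Zs.
  have pI : injective p.
    by apply: raddf_inj => x /(quotient_pi_eq0 Zs).
  have [|p' p'E] := linear_factor (h := idfun : {linear E -> E})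
      (quotient_pi_surj (Ks := Zs)).
    by move=> x /(quotient_pi_eq0 Zs).
  have ppK q : p (p' q) = q.
    by have [x <-] := quotient_pi_surj (Ks := Zs) q; rewrite p'E.
  have pg : flat_precover (p \o g).
    split=> // F f' /(gP F (p' \o f'))[h hE]; exists h => x.
    by rewrite /= hE /= ppK.
  have ext0 : Ext1_zero M (submod (submodClosed_of_set Zs)).
    move=> P0 P1 P2 e d1 d2 _ c _.
    have [|b bE] := @linear_exists _ P0 (submod (submodClosed_of_set Zs)) (fun=> 0).
      by move=> a x y; rewrite scaler0 addr0.
    exists b => x; rewrite bE; apply/val_inj; rewrite raddf0.
    by apply/(submodClosed_of_setP Zs); apply: (valP (c x)).
  have [h hE] := h5 E _ injE ext0 (p \o f) G _ pg.
  by exists h => x; apply: pI; apply: hE.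
have h24 : (forall (E : lmodType R) (i : {linear M -> E}),
      injective_envelope i -> fpc_domain M E) ->
    exists (F : lmodType R) (j : {linear M -> F}), flat F /\ injective j.
  move=> h2; have [E [i iE]] := injective_envelope_exists M.
  by case: (iE) => _ [iI _]; apply: (embed E i iI (h2 E i iE)).
tfae.
- by move=> h1 E i [injE _]; apply: h1.
(* Condition (3) is reached through (4), (5) and (1), since character modules of flat modules are
   injective. *)
- by move=> /h24/h45/h51 h1 F /charmod_injective; apply: h1.
- move=> h3; have [F [j [flF jI]]] := embeds_in_character_module M.
  exact: (embed _ j jI (h3 F flF)).
- exact: h45.
- exact: h51.
Qed.
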